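(* Let $M\subset B(H,K)$ be an anti-TRO, that is, as a set $M$ is equal to a sub-TRO of $B(H,K)$, and it is considered as a C*-ternary ring with triple product $[xyz]:=-xy^*z$. Then the standard embedding $\mathcal A_0(M)$ is *-isomorphic to the *-algebra $$\mathcal B_0=\left\{\begin{bmatrix}\sum_ix_iy_i^*&z\\ w^*&\sum_ju_j^*v_j\end{bmatrix}:x_i,y_i,u_j,v_j,z,w\in M\right\}\subset B(K\oplus H)$$ (finite sums) with multiplication $$\begin{bmatrix}\alpha&z\\ w^*&\beta\end{bmatrix}\cdot\begin{bmatrix}\alpha'&z'\\ w'^*&\beta'\end{bmatrix}=\begin{bmatrix}-\alpha\alpha'+zw'^*&-\alpha z'-z\beta'\\ -w^*\alpha'-\beta w'^*&w^*z'-\beta\beta'\end{bmatrix}$$ and involution $$\begin{bmatrix}\alpha&z\\ w^*&\beta\end{bmatrix}^*=\begin{bmatrix}\alpha^*&w\\ z^*&\beta^*\end{bmatrix},$$ via the map determined (by linear extension in the diagonal entries) by $$\mathcal A_0(M)\ni\begin{bmatrix}\ell(x,y)&z\\ \overline w&r(u,v)\end{bmatrix}\mapsto\begin{bmatrix}xy^*&z\\ w^*&u^*v\end{bmatrix}\in\mathcal B_0.$$ Moreover, this *-isomorphism extends to a bicontinuous *-isomorphism of the normed standard embedding $\mathcal A(M)$ onto the norm closure $\mathcal B$ of $\mathcal B_0$ in $B(K\oplus H)$ (with the product and involution extended by continuity).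
   Context: $H,K$ are complex Hilbert spaces. A TRO (ternary ring of operators) is a norm-closed subspace $V\subset B(H,K)$ with $VV^*V\subset V$. An associative triple system (of the second kind) is a complex vector space $M$ with a map $(x,y,z)\mapsto[xyz]$, $M^3\to M$, linear in $x$ and $z$, conjugate-linear in $y$, with $[[xyz]uv]=[x[uzy]v]=[xy[zuv]]$. A C*-ternary ring is an associative triple system that is also a complex Banach space with $\|[xyz]\|\le\|x\|\|y\|\|z\|$ and $\|[xxx]\|=\|x\|^3$. Standard embedding. For $g,h\in M$ put $\ell(g,h)=([gh\,\cdot],[hg\,\cdot])$ and $r(g,h)=([\,\cdot\, gh],[\,\cdot\, hg])$, pairs of operators on $M$. On pairs $A=(A_1,A_2)$ scalars act by $\lambda(A_1,A_2)=(\lambda A_1,\overline\lambda A_2)$, and $\overline{(A_1,A_2)}=(A_2,A_1)$. Let $L_0(M)=\operatorname{span}\{\ell(g,h)\}$ with product $AA'=(A_1A_1',A_2'A_2)$ and $R_0(M)=\operatorname{span}\{r(g,h)\}$ with product $B\circ B'=(B_1'B_1,B_2B_2')$. Let $L(M)$, $R(M)$ be the closures of $L_0(M)$, $R_0(M)$ in $B(M\oplus M)$, the pair $(A_1,A_2)$ acting diagonally ($M\oplus M$ with the max norm). Let $\overline M=\{\overline f:f\in M\}$ be the conjugate space of $M$ ($\lambda\overline f=\overline{\overline\lambda f}$). Actions: $A\cdot f=A_1f$, $f\cdot B=B_1f$, $B\cdot\overline f=\overline{B_2f}$, $\overline f\cdot A=\overline{A_2f}$. The standard embedding $\mathcal A_0(M)$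 (resp. normed standard embedding $\mathcal A(M)$) is the *-algebra of matrices $\begin{bmatrix}A&f\\ \overline g&B\end{bmatrix}$ with $f,g\in M$ and $A\in L_0(M)$, $B\in R_0(M)$ (resp. $A\in L(M)$, $B\in R(M)$), with product $$\begin{bmatrix}A&f\\ \overline g&B\end{bmatrix}\begin{bmatrix}A'&f'\\ \overline{g'}&B'\end{bmatrix}=\begin{bmatrix}AA'+\ell(f,g')&A\cdot f'+f\cdot B'\\ \overline g\cdot A'+B\cdot\overline{g'}&r(g,f')+B\circ B'\end{bmatrix}$$ and involution $\begin{bmatrix}A&f\\ \overline g&B\end{bmatrix}^\#=\begin{bmatrix}\overline A&g\\ \overline f&\overline B\end{bmatrix}$. The norm on $\mathcal A(M)$ is $\|a\|=\|\pi(a)\|$, where $\pi(a)\in B(M\oplus R(M))$ is $\pi\left(\begin{bmatrix}A&f\\ \overline g&B\end{bmatrix}\right)(f',B')=(A\cdot f'+f\cdot B',\ r(g,f')+B\circ B')$ and $M\oplus R(M)$ has the norm $(\|f'\|^2+\|B'\|^2)^{1/2}$. *)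

(* Defs.v *)
From HB Require Import structures.
From mathcomp Require Import all_boot all_order all_algebra.
From mathcomp Require Import complex ring lra.
From mathcomp Require Import all_classical all_reals all_analysis.

Set Implicit Arguments.
Unset Strict Implicit.
Unset Printing Implicit Defensive.

Import Order.TTheory GRing.Theory Num.Theory.
Import numFieldNormedType.Exports.

Local Open Scope classical_set_scope.
Local Open Scope ring_scope.

(* The norm of a [normedModType R[i]] takes its values in [R[i]]; [rnorm] is
   the same number as an element of [R]. *)
Definition rnorm (R : realType) (V : normedModType R[i]) (x : V) : R :=
  complex.Re `|x|.

Lemma Re_normcE (R : realType) (l : R[i]) : (complex.Re `|l|)%:C%C = `|l|.
Proof.
have : `|l| \is Num.real by exact: normr_real.
by move=> /complex_realP[r ->].
Qed.

Lemma Re_normc_ge0 (R : realType) (l : R[i]) : 0 <= complex.Re `|l|.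
Proof. by rewrite -lecR Re_normcE normr_ge0. Qed.

Lemma Re_normcV (R : realType) (l : R[i]) :
  complex.Re `|l^-1| = (complex.Re `|l|)^-1.
Proof.
by apply: (fmorph_inj (real_complex R)); rewrite fmorphV /= !Re_normcE normfV.
Qed.

Section rnorm_theory.
Variables (R : realType) (V : normedModType R[i]).
Implicit Types x y : V.

Lemma rnormE x : (rnorm x)%:C%C = `|x|.
Proof.
rewrite /rnorm; have : `|x| \is Num.real by exact: normr_real.
by move=> /complex_realP[r ->].
Qed.

Lemma ler_rnorm x y : (rnorm x <= rnorm y) = (`|x| <= `|y|).
Proof. by rewrite -!rnormE lecR. Qed.

Lemma rnorm_ge0 x : 0 <= rnorm x.
Proof. by rewrite -lecR rnormE normr_ge0. Qed.

Lemma rnorm0 : rnorm (0 : V) = 0.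
Proof. by rewrite /rnorm normr0. Qed.

Lemma rnorm_eq0 x : rnorm x = 0 -> x = 0.
Proof.
move=> x0; apply/eqP; rewrite -normr_eq0 -rnormE x0.
by apply/eqP.
Qed.

Lemma ler_rnormD x y : rnorm (x + y) <= rnorm x + rnorm y.
Proof. by rewrite -lecR rmorphD/= !rnormE ler_normD. Qed.

Lemma rnormZ (l : R[i]) x : rnorm (l *: x) = complex.Re `|l| * rnorm x.
Proof.
apply: (fmorph_inj (real_complex R)); by rewrite rmorphM /= !rnormE normrZ Re_normcE.
Qed.

End rnorm_theory.

HB.mixin Record isHilbert (R : realType) H & CompleteNormedModule R[i] H := {
  inner : H -> H -> R[i] ;
  inner_linear : forall y l x x', inner (l *: x + x') y = l * inner x y + inner x' y ;
  inner_conj : forall x y, inner y x = (inner x y)^* ;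
  inner_norm : forall x, inner x x = `|x| ^+ 2 ;
}.

#[short(type="hilbertType")]
HB.structure Definition Hilbert (R : realType) :=
  {H of CompleteNormedModule R[i] H & isHilbert R H}.

Section bounded_operators.
Variables (R : realType) (V W : normedModType R[i]).

Definition bounded_linear : {pred V -> W} := fun f =>
  `[< linear f /\ exists c : R, forall x, rnorm (f x) <= c * rnorm x >].

Record bop := Bop { bop_fun :> V -> W ; bop_mem : bop_fun \in bounded_linear }.

HB.instance Definition _ := [isSub for bop_fun].
HB.instance Definition _ := [Choice of bop by <:].

Lemma bounded_linear_submod : submod_closed bounded_linear.
Proof.
split.
  apply/asboolP; split; first by move=> l x y; rewrite scaler0 addr0.
  by exists 0 => x; rewrite mul0r [X in rnorm X](_ : _ = 0)// rnorm0.
move=> l f g /asboolP[lf [c cf]] /asboolP[lg [d dg]]; apply/asboolP; split.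
  move=> a x y; rewrite !fctE /= lf lg !scalerDr !scalerA -!addrA [l * a]mulrC.
  by congr (_ + _); rewrite addrCA.
exists (complex.Re `|l| * c + d) => x.
rewrite (le_trans (ler_rnormD _ _))// mulrDl lerD ?dg// rnormZ -mulrA.
by rewrite ler_wpM2l ?cf// Re_normc_ge0.
Qed.

HB.instance Definition _ :=
  GRing.isSubmodClosed.Build R[i] (V -> W) bounded_linear bounded_linear_submod.
HB.instance Definition _ := [SubChoice_isSubLmodule of bop by <:].

Definition opnorm (f : V -> W) : R :=
  sup [set rnorm (f x) | x in [set x | rnorm x <= 1]].

Lemma bop_linear (f : bop) : linear f.
Proof. by have /asboolP[] := bop_mem f. Qed.

Lemma bop0 (f : bop) : f 0 = 0.
Proof. by have := bop_linear f (-1) 0 0; rewrite scaler0 addr0 scaleN1r addNr. Qed.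

Lemma bopZ (f : bop) l x : f (l *: x) = l *: f x.
Proof. by have := bop_linear f l x 0; rewrite !addr0 bop0 addr0. Qed.

Lemma bop_has_sup (f : bop) :
  has_sup [set rnorm (f x) | x in [set x | rnorm x <= 1]].
Proof.
split; first by exists (rnorm (f 0)), 0 => //=; rewrite rnorm0 ler01.
have /asboolP[_ [c cf]] := bop_mem f.
exists `|c| => _ [x /= x1 <-]; rewrite (le_trans (cf x))//.
rewrite (le_trans (ler_wpM2r (rnorm_ge0 x) (ler_norm c)))//.
by rewrite ler_piMr.
Qed.

Lemma opnorm_ub (f : bop) x : rnorm x <= 1 -> rnorm (f x) <= opnorm f.
Proof. by move=> x1; apply: (sup_upper_bound (bop_has_sup f)); exists x. Qed.

Lemma opnorm_le (f : bop) c :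
  (forall x, rnorm x <= 1 -> rnorm (f x) <= c) -> opnorm f <= c.
Proof.
move=> fc; apply: ge_sup; first by case: (bop_has_sup f).
by move=> _ [x /= x1 <-]; exact: fc.
Qed.

Lemma opnorm_bound (f : bop) x : rnorm (f x) <= opnorm f * rnorm x.
Proof.
have [->|x0] := eqVneq x 0; first by rewrite bop0 !rnorm0 mulr0.
have x_gt0 : 0 < rnorm x.
  by rewrite lt_neqAle rnorm_ge0 andbT eq_sym; apply: contra_neq x0 => /rnorm_eq0.
rewrite -ler_pdivrMr// mulrC.
have Re_inv : complex.Re `|(rnorm x)^-1%:C%C| = (rnorm x)^-1.
  by rewrite ger0_norm// lecR invr_ge0 rnorm_ge0.
rewrite -[X in X * _]Re_inv -rnormZ -bopZ opnorm_ub// rnormZ Re_inv mulVf//.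
by rewrite gt_eqF.
Qed.

Definition bop_norm (f : bop) : R[i] := (opnorm f)%:C%C.

Lemma bop_normD f g : bop_norm (f + g) <= bop_norm f + bop_norm g.
Proof.
rewrite /bop_norm -rmorphD lecR; apply: opnorm_le => x x1.
by rewrite (le_trans (ler_rnormD _ _))// lerD// opnorm_ub.
Qed.

Lemma opnormZ_le l (f : bop) : opnorm (l *: f : bop) <= complex.Re `|l| * opnorm f.
Proof.
by apply: opnorm_le => x x1; rewrite rnormZ ler_wpM2l ?opnorm_ub ?Re_normc_ge0.
Qed.

Lemma bop_normZ l f : bop_norm (l *: f) = `|l| * bop_norm f.
Proof.
rewrite /bop_norm -[in RHS]Re_normcE -rmorphM; congr _%:C%C; apply/eqP.
rewrite eq_le opnormZ_le andTb; have [->|l0] := eqVneq l 0.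
  rewrite normr0 mul0r (le_trans (rnorm_ge0 ((0 *: f) 0)))// opnorm_ub//.
  by rewrite rnorm0 ler01.
have Re_gt0 : 0 < complex.Re `|l| by rewrite -ltcR Re_normcE normr_gt0.
rewrite mulrC -ler_pdivlMr//.
rewrite -[in X in X <= _](scalerK l0 f) (le_trans (opnormZ_le _ _))// mulrC.
by rewrite Re_normcV.
Qed.

Lemma bop_norm0_eq0 f : bop_norm f = 0 -> f = 0.
Proof.
move=> /(@fmorph_inj _ _ (real_complex R) _ 0) f0; apply/val_inj/funext => x /=.
apply: rnorm_eq0; apply/eqP; rewrite eq_le rnorm_ge0 andbT.
by rewrite (le_trans (opnorm_bound _ _))// f0 mul0r.
Qed.

HB.instance Definition _ :=
  Lmodule_isNormed.Build R[i] bop bop_normD bop_normZ bop_norm0_eq0.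

End bounded_operators.
Arguments bop {R} V W.

Section composition.
Variables (R : realType) (U V W : normedModType R[i]).
Variables (g : bop V W) (f : bop U V).

Lemma bcomp_subproof : g \o f \in @bounded_linear R U W.
Proof.
apply/asboolP; split; first by move=> l x y /=; rewrite !bop_linear.
exists (`|opnorm g| * opnorm f) => x /=; rewrite -mulrA.
rewrite (le_trans (opnorm_bound _ _))//.
rewrite (le_trans (ler_wpM2r (rnorm_ge0 _) (ler_norm _)))//.
by rewrite ler_wpM2l// opnorm_bound.
Qed.

Definition bcomp : bop U W := Bop bcomp_subproof.

End composition.
Notation "g \bo f" := (bcomp g f)
  (at level 40, left associativity, format "g  \bo  f").

(* The adjoint, picked by choice among the bounded operators satisfying the
   defining identity; there is exactly one by the Riesz theorem. *)
Definition adj (R : realType) (H K : hilbertType R) (T : bop H K) : bop K H :=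
  xget 0 [set S : bop K H | forall x y, inner (T x) y = inner x (S y)].

Definition l2norm (R : realType) (a b : R) : R := Num.sqrt (a ^+ 2 + b ^+ 2).

Lemma l2normD (R : realType) (a b c d : R) :
  l2norm (a + b) (c + d) <= l2norm a c + l2norm b d.
Proof.
have ge0 (x y : R) : 0 <= x ^+ 2 + y ^+ 2 by rewrite addr_ge0 ?sqr_ge0.
rewrite /l2norm -(@ler_pXn2r _ 2)// ?nnegrE ?addr_ge0 ?sqrtr_ge0//.
rewrite [leRHS]sqrrD !sqr_sqrtr// -sqrtrM//.
suff : a * b + c * d <= Num.sqrt ((a ^+ 2 + c ^+ 2) * (b ^+ 2 + d ^+ 2)).
  by rewrite -mulr_natl -subr_ge0 => ?; nra.
rewrite (le_trans (ler_norm _))// -sqrtr_sqr ler_wsqrtr//.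
have := sqr_ge0 (a * d - b * c); nra.
Qed.

(* Direct sum with the norm [(|v|^2 + |w|^2)^(1/2)]; on two Hilbert spaces it
   is the Hilbert space direct sum. *)
Definition l2sum (V W : Type) : Type := (V * W)%type.

Section l2sum.
Variables (R : realType) (V W : normedModType R[i]).

HB.instance Definition _ := GRing.Lmodule.copy (l2sum V W) (V * W)%type.

Definition l2sum_norm (p : l2sum V W) : R[i] :=
  (l2norm (rnorm p.1) (rnorm p.2))%:C%C.

Lemma l2sum_normD p q : l2sum_norm (p + q) <= l2sum_norm p + l2sum_norm q.
Proof.
rewrite /l2sum_norm -rmorphD lecR (le_trans _ (l2normD _ _ _ _))//.
by rewrite ler_wsqrtr// lerD// lerXn2r ?nnegrE ?addr_ge0 ?rnorm_ge0 ?ler_rnormD.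
Qed.

Lemma l2sum_normZ l p : l2sum_norm (l *: p) = `|l| * l2sum_norm p.
Proof.
rewrite /l2sum_norm -[in RHS]Re_normcE -rmorphM; congr _%:C%C.
rewrite /l2norm !rnormZ !exprMn -mulrDr sqrtrM ?sqr_ge0// sqrtr_sqr.
by rewrite ger0_norm// Re_normc_ge0.
Qed.

Lemma l2sum_norm0_eq0 p : l2sum_norm p = 0 -> p = 0.
Proof.
move=> /(@fmorph_inj _ _ (real_complex R) _ 0)/eqP.
rewrite sqrtr_eq0 => p0.
have [p1 p2] : rnorm p.1 = 0 /\ rnorm p.2 = 0.
  by have := (rnorm_ge0 p.1, rnorm_ge0 p.2); move=> [? ?]; split; nra.
by case: p p1 p2 {p0} => v w /= /rnorm_eq0-> /rnorm_eq0->.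
Qed.

HB.instance Definition _ := Lmodule_isNormed.Build R[i] (l2sum V W)
  l2sum_normD l2sum_normZ l2sum_norm0_eq0.

Lemma rnorm_l2sum (p : l2sum V W) : rnorm p = l2norm (rnorm p.1) (rnorm p.2).
Proof. by []. Qed.

Lemma rnorm_fst (p : l2sum V W) : rnorm p.1 <= rnorm p.
Proof.
rewrite rnorm_l2sum -[leLHS]ger0_norm ?rnorm_ge0// -sqrtr_sqr ler_wsqrtr//.
by rewrite lerDl sqr_ge0.
Qed.

Lemma rnorm_snd (p : l2sum V W) : rnorm p.2 <= rnorm p.
Proof.
rewrite rnorm_l2sum -[leLHS]ger0_norm ?rnorm_ge0// -sqrtr_sqr ler_wsqrtr//.
by rewrite lerDr sqr_ge0.
Qed.

Lemma inj1_subproof : (fun v : V => (v, 0) : l2sum V W) \in @bounded_linear R V (l2sum V W).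
Proof.
apply/asboolP; split; first by move=> l x y; congr pair; rewrite /= scaler0 addr0.
exists 1 => v; rewrite mul1r rnorm_l2sum/= rnorm0 /l2norm expr0n addr0.
by rewrite sqrtr_sqr ger0_norm ?rnorm_ge0.
Qed.

Lemma inj2_subproof : (fun w : W => (0, w) : l2sum V W) \in @bounded_linear R W (l2sum V W).
Proof.
apply/asboolP; split; first by move=> l x y; congr pair; rewrite /= scaler0 addr0.
exists 1 => v; rewrite mul1r rnorm_l2sum/= rnorm0 /l2norm expr0n add0r.
by rewrite sqrtr_sqr ger0_norm ?rnorm_ge0.
Qed.

Lemma proj1_subproof : (fun p : l2sum V W => p.1) \in @bounded_linear R (l2sum V W) V.
Proof.
by apply/asboolP; split=> //; exists 1 => p; rewrite mul1r rnorm_fst.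
Qed.

Lemma proj2_subproof : (fun p : l2sum V W => p.2) \in @bounded_linear R (l2sum V W) W.
Proof.
by apply/asboolP; split=> //; exists 1 => p; rewrite mul1r rnorm_snd.
Qed.

Definition inj1 : bop V (l2sum V W) := Bop inj1_subproof.
Definition inj2 : bop W (l2sum V W) := Bop inj2_subproof.
Definition proj1 : bop (l2sum V W) V := Bop proj1_subproof.
Definition proj2 : bop (l2sum V W) W := Bop proj2_subproof.

Definition block (a : bop V V) (b : bop W V) (c : bop V W) (d : bop W W) :
    bop (l2sum V W) (l2sum V W) :=
  inj1 \bo a \bo proj1 + inj1 \bo b \bo proj2 +
  inj2 \bo c \bo proj1 + inj2 \bo d \bo proj2.

Lemma blockE a b c d (p : l2sum V W) :
  block a b c d p = (a p.1 + b p.2, c p.1 + d p.2).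
Proof. by congr pair; rewrite /= !(addr0, add0r). Qed.

Definition block11 (T : bop (l2sum V W) (l2sum V W)) : bop V V := proj1 \bo T \bo inj1.
Definition block12 (T : bop (l2sum V W) (l2sum V W)) : bop W V := proj1 \bo T \bo inj2.
Definition block21 (T : bop (l2sum V W) (l2sum V W)) : bop V W := proj2 \bo T \bo inj1.
Definition block22 (T : bop (l2sum V W) (l2sum V W)) : bop W W := proj2 \bo T \bo inj2.

End l2sum.

Definition conjugate (V : Type) : Type := V.

Section conjugate.
Variables (R : realType) (V : lmodType R[i]).

HB.instance Definition _ := GRing.Zmodule.copy (conjugate V) V.

Definition conjugate_scale (l : R[i]) (f : conjugate V) : conjugate V :=
  l^* *: (f : V).

Lemma conjugate_scaleA a b f :
  conjugate_scale a (conjugate_scale b f) = conjugate_scale (a * b) f.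
Proof. by rewrite /conjugate_scale scalerA rmorphM. Qed.

Lemma conjugate_scale1 : left_id 1 conjugate_scale.
Proof. by move=> f; rewrite /conjugate_scale rmorph1 scale1r. Qed.

Lemma conjugate_scaleDr : right_distributive conjugate_scale +%R.
Proof. by move=> l f g; rewrite /conjugate_scale scalerDr. Qed.

Lemma conjugate_scaleDl f : {morph conjugate_scale^~ f : a b / a + b}.
Proof. by move=> a b; rewrite /conjugate_scale rmorphD scalerDl. Qed.

HB.instance Definition _ := GRing.Zmodule_isLmodule.Build R[i] (conjugate V)
  conjugate_scaleA conjugate_scale1 conjugate_scaleDr conjugate_scaleDl.

End conjugate.

Section star_algebras.
Variable R : realType.

Record star_algebra (U : lmodType R[i]) (S : set U)
    (mul : U -> U -> U) (star : U -> U) : Prop := {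
  star_algebra0 : S 0 ;
  star_algebraP : forall l a b, S a -> S b -> S (l *: a + b) ;
  star_algebraM : forall a b, S a -> S b -> S (mul a b) ;
  star_algebra_star : forall a, S a -> S (star a) ;
  star_algebraMl : forall l a b c, S a -> S b -> S c ->
    mul (l *: a + b) c = l *: mul a c + mul b c ;
  star_algebraMr : forall l a b c, S a -> S b -> S c ->
    mul c (l *: a + b) = l *: mul c a + mul c b ;
  star_algebraA : forall a b c, S a -> S b -> S c ->
    mul a (mul b c) = mul (mul a b) c ;
  star_algebra_starP : forall l a b, S a -> S b ->
    star (l *: a + b) = l^* *: star a + star b ;
  star_algebra_starM : forall a b, S a -> S b ->
    star (mul a b) = mul (star b) (star a) ;
  star_algebra_starK : forall a, S a -> star (star a) = a ;
}.

Record star_isomorphism (U V : lmodType R[i])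
    (S : set U) (mulS : U -> U -> U) (starS : U -> U)
    (T : set V) (mulT : V -> V -> V) (starT : V -> V)
    (phi : U -> V) : Prop := {
  star_iso_dom : star_algebra S mulS starS ;
  star_iso_cod : star_algebra T mulT starT ;
  star_iso_bij : set_bij S T phi ;
  star_iso_lin : forall l a b, S a -> S b ->
    phi (l *: a + b) = l *: phi a + phi b ;
  star_isoM : forall a b, S a -> S b -> phi (mulS a b) = mulT (phi a) (phi b) ;
  star_iso_star : forall a, S a -> phi (starS a) = starT (phi a) ;
}.

(* Continuity of [phi] on [S], and continuity of its inverse on [phi @` S], for
   the distances given by the norms [nU] and [nV]. *)
Definition bicontinuous (U V : zmodType) (nU : U -> R) (nV : V -> R)
    (S : set U) (phi : U -> V) : Prop :=
  (forall a, S a -> forall e : R, 0 < e -> exists2 d : R, 0 < d &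
    forall b, S b -> nU (b - a) < d -> nV (phi b - phi a) < e) /\
  (forall a, S a -> forall e : R, 0 < e -> exists2 d : R, 0 < d &
    forall b, S b -> nV (phi b - phi a) < d -> nU (b - a) < e).

Definition lspan (U : lmodType R[i]) (S : set U) : set U :=
  [set \sum_(p <- s) p.1 *: p.2 |
    s in [set s : seq (R[i] * U) | forall p, p \in s -> S p.2]].

End star_algebras.

(* Associative triple systems of the second kind. *)
Record triple_system (R : realType) (M : lmodType R[i])
    (t : M -> M -> M -> M) : Prop := {
  tripleDl : forall l x x' y z, t (l *: x + x') y z = l *: t x y z + t x' y z ;
  tripleDm : forall l x y y' z, t x (l *: y + y') z = l^* *: t x y z + t x y' z ;
  tripleDr : forall l x y z z', t x y (l *: z + z') = l *: t x y z + t x y z' ;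
  tripleAm : forall x y z u v, t (t x y z) u v = t x (t u z y) v ;
  tripleA : forall x y z u v, t (t x y z) u v = t x y (t z u v) ;
}.

Record cstar_ternary_ring (R : realType) (M : normedModType R[i])
    (t : M -> M -> M -> M) : Prop := {
  cstar_triple : triple_system t ;
  cstar_complete : forall F : set_system M, ProperFilter F -> cauchy F -> cvg F ;
  cstar_norm : forall x y z, `|t x y z| <= `|x| * `|y| * `|z| ;
  cstar_norm3 : forall x, `|t x x x| = `|x| ^+ 3 ;
}.

Section standard_embedding.
Variables (R : realType) (M : normedModType R[i]) (t : M -> M -> M -> M).

(* Pairs [(A_1, A_2)], with scalars acting by [l (A_1, A_2) = (l A_1, l^* A_2)]. *)
Definition opair : Type := ((M -> M) * conjugate (M -> M))%type.
HB.instance Definition _ := GRing.Lmodule.on opair.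

Definition ell (g h : M) : opair := (t g h, t h g).
Definition arr (g h : M) : opair := (fun x => t x g h, fun x => t x h g).

Definition opair_bar (A : opair) : opair := (A.2, A.1).
Definition lmul (A A' : opair) : opair := (A.1 \o A'.1, A'.2 \o A.2).
Definition rmul (B B' : opair) : opair := (B'.1 \o B.1, B.2 \o B'.2).

Definition L0 : set opair := lspan [set ell g h | g in setT & h in setT].
Definition R0 : set opair := lspan [set arr g h | g in setT & h in setT].

(* The norm of the product [M * M] is the max norm. *)
Definition diag (A : opair) (p : M * M) : M * M := (A.1 p.1, A.2 p.2).

Definition opair_closure (S : set opair) : set opair :=
  [set A | exists2 T : bop (M * M)%type (M * M)%type,
    closure [set T : bop (M * M)%type (M * M)%type |
      exists2 A', S A' & T = diag A' :> (_ -> _)] T &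
    T = diag A :> (_ -> _)].

Definition Lcl : set opair := opair_closure L0.
Definition Rcl : set opair := opair_closure R0.

Definition opair_norm (A : opair) : R := opnorm (diag A).

(* Matrices [[A, f], [\bar g, B]], stored as pairs of rows. *)
Definition embmx : Type := ((opair * M) * (conjugate M * opair))%type.
HB.instance Definition _ := GRing.Lmodule.on embmx.

Definition Mx (A : opair) (f g : M) (B : opair) : embmx := ((A, f), (g, B)).

Definition emb_mul (a a' : embmx) : embmx :=
  let: ((A, f), (g, B)) := a in
  let: ((A', f'), (g', B')) := a' in
  Mx (lmul A A' + ell f g') (A.1 f' + B'.1 f)
     (A'.2 g + B.2 g') (arr g f' + rmul B B').

Definition emb_star (a : embmx) : embmx :=
  let: ((A, f), (g, B)) := a in Mx (opair_bar A) g f (opair_bar B).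

Definition emb0 : set embmx := [set a | L0 a.1.1 /\ R0 a.2.2].
Definition emb : set embmx := [set a | Lcl a.1.1 /\ Rcl a.2.2].

Definition emb_rep (a : embmx) (p : M * opair) : M * opair :=
  let: ((A, f), (g, B)) := a in
  let: (f', B') := p in
  (A.1 f' + B'.1 f, arr g f' + rmul B B').

Definition emb_vec_norm (p : M * opair) : R := l2norm (rnorm p.1) (opair_norm p.2).

(* The operator norm of [emb_rep a] on the direct sum of [M] and [Rcl]. *)
Definition emb_norm (a : embmx) : R :=
  sup [set emb_vec_norm (emb_rep a p) |
    p in [set p : M * opair | Rcl p.2 /\ emb_vec_norm p <= 1]].

End standard_embedding.

Record tro (R : realType) (H K : hilbertType R) := Tro {
  tro_set : {pred bop H K} ;
  tro_submod : submod_closed tro_set ;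
  tro_closed : closed [set` tro_set] ;
  tro_triple : forall x y z, x \in tro_set -> y \in tro_set -> z \in tro_set ->
    x \bo adj y \bo z \in tro_set ;
}.

Record tro_sort (R : realType) (H K : hilbertType R) (V : tro H K) := TroElt {
  tro_val :> bop H K ;
  tro_mem : tro_val \in tro_set V }.

Section anti_tro.
Variables (R : realType) (H K : hilbertType R) (V : tro H K).

HB.instance Definition _ := [isSub for @tro_val R H K V].
HB.instance Definition _ := [Choice of tro_sort V by <:].
HB.instance Definition _ :=
  GRing.isSubmodClosed.Build R[i] (bop H K) (tro_set V) (tro_submod V).
HB.instance Definition _ := [SubChoice_isSubLmodule of tro_sort V by <:].

Definition tro_norm (x : tro_sort V) : R[i] := `|tro_val x|.

Lemma tro_normD x y : tro_norm (x + y) <= tro_norm x + tro_norm y.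
Proof. exact: ler_normD. Qed.

Lemma tro_normZ l x : tro_norm (l *: x) = `|l| * tro_norm x.
Proof. exact: normrZ. Qed.

Lemma tro_norm0_eq0 x : tro_norm x = 0 -> x = 0.
Proof. by move=> /normr0_eq0 x0; exact: val_inj. Qed.

HB.instance Definition _ := Lmodule_isNormed.Build R[i] (tro_sort V)
  tro_normD tro_normZ tro_norm0_eq0.

Lemma anti_triple_subproof (x y z : tro_sort V) :
  - (x \bo adj y \bo z) \in tro_set V.
Proof. by rewrite rpredN tro_triple// tro_mem. Qed.

Definition anti_triple (x y z : tro_sort V) : tro_sort V :=
  TroElt (anti_triple_subproof x y z).

Definition fsumsK : set (bop K K) :=
  [set \sum_(p <- s) (tro_val p.1 \bo adj p.2) | s in [set: seq (tro_sort V * tro_sort V)]].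
Definition fsumsH : set (bop H H) :=
  [set \sum_(p <- s) (adj p.1 \bo tro_val p.2) | s in [set: seq (tro_sort V * tro_sort V)]].

Definition B0 : set (bop (l2sum K H) (l2sum K H)) :=
  [set T | exists a b (z w : tro_sort V),
    [/\ fsumsK a, fsumsH b & T = block a z (adj w) b]].

End anti_tro.

Section block_algebra.
Variables (R : realType) (H K : hilbertType R).
Implicit Types T : bop (l2sum K H) (l2sum K H).

(* The lower left block [c] stands for [w^*]. Both operations are defined on all
   block operators; they are continuous, so on the norm closure of [B0] they are
   the extensions by continuity of the operations of [B0]. *)
Definition block_mul T T' : bop (l2sum K H) (l2sum K H) :=
  let a := block11 T in let a' := block11 T' in
  let z := block12 T in let z' := block12 T' in
  let c := block21 T in let c' := block21 T' in
  let b := block22 T in let b' := block22 T' in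
  block (- (a \bo a') + z \bo c') (- (a \bo z') - z \bo b')
        (- (c \bo a') - b \bo c') (c \bo z' - b \bo b').

Definition block_star T : bop (l2sum K H) (l2sum K H) :=
  block (adj (block11 T)) (adj (block21 T)) (adj (block12 T)) (adj (block22 T)).

End block_algebra.

(* Main.v *)
Require Import Defs.
From mathcomp Require Import all_boot all_order all_algebra.
From mathcomp Require Import complex ring lra.
From mathcomp Require Import all_classical all_reals all_analysis.
Import Order.TTheory GRing.Theory Num.Theory.
Import numFieldNormedType.Exports.

(* The map [alpha |-> (f |-> - alpha f, f |-> - alpha^* f)] identifies the span of
   [V V^*] with [L0], and it is isometric by a spectral radius argument, so it
   extends to the closures; the other corner is the same statement for the dual
   TRO [V^*]. The norm of [pi(a)] is equivalent to that of the block operator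
   attached to [a]: evaluating [pi(a)] on the vectors [(f', 0)] controls the left
   column, and on [(0, z^* z)] and [(0, beta^* )] the right column, because
   [|z z^* z| = |z|^3]. *)

Set Implicit Arguments.
Unset Strict Implicit.
Unset Printing Implicit Defensive.

Local Open Scope classical_set_scope.
Local Open Scope ring_scope.

(** A diagonal entry is only given as a pair of maps on $M$, and in $L(M)$ as a limit of such pairs,
    so no formula reads the operator off the entry. The correspondence is therefore set up as a
    relation, [emb_rel], and it hinges on one inequality: an operator in the span of $VV^*$ is
    bounded by the norm of its action on $V$. This inequality gives well-definedness of the linear
    extension, isometry on the diagonal and, by completeness, the passage to closures. An
    approximate unit would be the usual tool for it; powers of $a^*a$ need only the C*-identity and
    finite sums. No algebra law is verified inside the standard embedding. The laws hold for all
    block operators, since a twist by signs and by $i$ turns their product into composition, and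
    they are pulled back along the injective relation. The finite sums and their closures satisfy
    the same axioms, so the algebraic and the normed isomorphism are two instances of one argument.
    The constant 4 in the norm estimates counts the blocks; bicontinuity does not require a sharper
    one. *)

Section real_lemmas.
Variable R : realType.
Implicit Types a b c e : R.

Lemma ler_addsmall a b c : 0 <= c -> (forall e, 0 < e -> a <= b + e * c) -> a <= b.
Proof.
move=> c0 H; apply/ler_addgt0Pr => e e0.
have c1 : 0 < c + 1 by rewrite ltr_wpDl.
rewrite (le_trans (H (e / (c + 1)) _)) ?divr_gt0// lerD2l mulrAC ler_pdivrMr//.
by rewrite ler_pM2l// lerDl.
Qed.

(** For [c > 0] this is the value at the minimizer [- b / c]. For [c = 0] or [c < 0] an explicit [t]
    makes the quadratic negative, unless [b = c = 0]. *)
Lemma sqr_le_discr a b c :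
  (forall t : R, 0 <= a + 2 * t * b + t ^+ 2 * c) -> b ^+ 2 <= a * c.
Proof.
move=> H.
have [c0|cn0] := eqVneq c 0.
  rewrite c0 mulr0; have [->|b0] := eqVneq b 0; first by rewrite expr0n.
  have := H (- (a + 1) / (2 * b)); rewrite c0 mulr0 addr0.
  have -> : 2 * (- (a + 1) / (2 * b)) * b = - (a + 1) by field.
  by move=> ?; exfalso; lra.
have a0 : 0 <= a by have := H 0; rewrite mulr0 mul0r expr0n mul0r !addr0.
have cp : 0 < c.
  rewrite lt_neqAle eq_sym cn0 /= leNgt; apply/negP => cneg.
  have := H ((a + 1 + 2 * `|b|) / (- c) + 1).
  set t := _ + 1 => Ht.
  have nc : 0 < - c by lra.
  have t1 : 1 <= t by rewrite lerDr divr_ge0 ?addr_ge0 ?mulr_ge0// ltW.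
  have tc : t * c = - (a + 1 + 2 * `|b|) + c by rewrite /t; field.
  have : b <= `|b| by exact: ler_norm.
  have key : 2 * t * b + t ^+ 2 * c = t * (2 * b - (a + 1 + 2 * `|b|) + c).
    by rewrite expr2 -[t * t * c]mulrA tc; ring.
  nra.
have := H (- b / c).
have -> : a + 2 * (- b / c) * b + (- b / c) ^+ 2 * c = (a * c - b ^+ 2) / c by field.
by rewrite pmulr_lge0 ?invr_gt0// subr_ge0.
Qed.

End real_lemmas.

(** * Closure and completeness in terms of the real-valued norm *)

Section rnorm_more.
Variables (R : realType) (V : normedModType R[i]).
Implicit Types x y : V.

Lemma rnormN x : rnorm (- x) = rnorm x.
Proof. by rewrite /rnorm normrN. Qed.

Lemma rnormB x y : rnorm (x - y) = rnorm (y - x).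
Proof. by rewrite /rnorm distrC. Qed.

Lemma ler_rnormB x y : rnorm (x - y) <= rnorm x + rnorm y.
Proof. by rewrite (le_trans (ler_rnormD _ _))// rnormN. Qed.

Lemma ler_rnorm_dist x y z : rnorm (x - z) <= rnorm (x - y) + rnorm (y - z).
Proof. by rewrite (le_trans _ (ler_rnormD _ _))// addrA subrK. Qed.

Lemma rnorm_sub_triangle x y : rnorm x <= rnorm y + rnorm (x - y).
Proof. by rewrite -{1}[x](subrK y) addrC ler_rnormD. Qed.

Lemma rnorm_gt0 x : x != 0 -> 0 < rnorm x.
Proof.
move=> x0; rewrite lt_neqAle rnorm_ge0 andbT eq_sym.
by apply: contra_neq x0 => /rnorm_eq0.
Qed.

Lemma rnormZr (r : R) x : rnorm (r%:C%C *: x) = `|r| * rnorm x.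
Proof. by rewrite rnormZ normc_def /= expr0n addr0 sqrtr_sqr. Qed.

Lemma rnorm_sum (I : Type) (s : seq I) (F : I -> V) :
  rnorm (\sum_(i <- s) F i) <= \sum_(i <- s) rnorm (F i).
Proof.
elim: s => [|i s IH]; first by rewrite !big_nil rnorm0.
by rewrite !big_cons (le_trans (ler_rnormD _ _))// lerD2l.
Qed.

(** The closure with real radii: [ball] takes its radii in [R[i]], while all estimates below live in
    [R]. *)
Definition ncl (S : set V) : set V :=
  [set x | forall e : R, 0 < e -> exists2 y, S y & rnorm (y - x) < e].

Lemma ball_rnorm x (e : R[i]) y : 0 < e -> ball x e y <-> rnorm (y - x) < complex.Re e.
Proof.
move=> e0; have er : (complex.Re e)%:C%C = e by rewrite RRe_real// gtr0_real.
by rewrite -ball_normE /ball_ /= rnormB -ltcR rnormE er.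
Qed.

Lemma nbhs_rnorm x (A : set V) :
  nbhs x A <-> exists2 e : R, 0 < e & forall y, rnorm (y - x) < e -> A y.
Proof.
split.
  move=> /nbhs_ballP[e /= e0 eA].
  have er : (complex.Re e)%:C%C = e by rewrite RRe_real// gtr0_real.
  exists (complex.Re e) => [|y]; first by rewrite -ltcR er.
  by move/(ball_rnorm _ _ e0)/eA.
move=> [e e0 eA]; apply/nbhs_ballP; have e0' : 0 < e%:C%C by rewrite ltcR.
by exists e%:C%C => //= y /(ball_rnorm _ _ e0'); exact: eA.
Qed.

Lemma closure_ncl (S : set V) : closure S = ncl S.
Proof.
apply/seteqP; split => x.
  move=> Sx e e0; have /Sx[y [Sy ey]] : nbhs x [set y | rnorm (y - x) < e].
    by apply/nbhs_rnorm; exists e.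
  by exists y.
move=> Sx A /nbhs_rnorm[e e0 eA]; have [y Sy ye] := Sx _ e0.
by exists y; split=> //; exact: eA.
Qed.

Lemma sub_ncl (S : set V) : S `<=` ncl S.
Proof. by move=> x Sx e e0; exists x => //; rewrite subrr rnorm0. Qed.

Lemma ncl_idem (S : set V) : ncl (ncl S) `<=` ncl S.
Proof.
move=> x Sx e e0; have e2 : 0 < e / 2 by rewrite divr_gt0.
have [y Sy ye] := Sx _ e2; have [z Sz ze] := Sy _ e2; exists z => //.
by rewrite (le_lt_trans (ler_rnorm_dist _ y _))// [e]splitr ltrD.
Qed.

(** Completeness without sequences: [P e x] says that [x] approximates with error [e], and the limit
    is reached with the same error. Later approximants exist only under an existential quantifier,
    so no sequence has to be chosen. *)
Definition rcomplete := forall P : R -> V -> Prop,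
  (forall e, 0 < e -> exists x, P e x) ->
  (forall e e' x y, 0 < e -> 0 < e' -> P e x -> P e' y -> rnorm (x - y) <= e + e') ->
  exists l, forall e x, 0 < e -> P e x -> rnorm (x - l) <= e.

End rnorm_more.

Lemma ncl_map (R : realType) (V W : normedModType R[i]) (S : set V) (T : set W)
    (f : V -> W) (c : R) : (forall x y, rnorm (f x - f y) <= c * rnorm (x - y)) ->
  (forall x, S x -> ncl T (f x)) -> forall x, ncl S x -> ncl T (f x).
Proof.
move=> fc fST x Sx; apply: ncl_idem => e e0.
have c1 : 0 < `|c| + 1 by rewrite ltr_wpDl.
have [y Sy ye] := Sx (e / (`|c| + 1)) (divr_gt0 e0 c1).
exists (f y); first exact: fST.
rewrite (le_lt_trans (fc _ _))// (@le_lt_trans _ _ ((`|c| + 1) * rnorm (y - x)))//.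
  by rewrite ler_wpM2r ?rnorm_ge0// (le_trans (ler_norm c))// lerDl.
by rewrite mulrC -ltr_pdivlMr.
Qed.

Section completeness.
Variable R : realType.

Lemma cauchy_cvg_rcomplete (V : normedModType R[i]) : rcomplete V ->
  forall F : set_system V, ProperFilter F -> cauchy F -> cvg F.
Proof.
move=> cV F FF Fc.
have Fb (e : R) : 0 < e -> exists x, F (ball x e%:C%C).
  by move=> e0; apply: (iffLR (cauchyP F) Fc); rewrite ltcR.
have e0c (e : R) : 0 < e -> 0 < e%:C%C by rewrite ltcR.
have [] := cV (fun e x => F (ball x e%:C%C)).
- exact: Fb.
- move=> e e' x y e0 e'0 Fx Fy; have [z [xz yz]] := filter_ex (filterI Fx Fy).
  move/(ball_rnorm _ _ (e0c _ e0)) : xz; move/(ball_rnorm _ _ (e0c _ e'0)) : yz => /= yz xz.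
  rewrite (le_trans (ler_rnorm_dist _ z _))// rnormB lerD//; exact: ltW.
move=> l Fl; apply/cvg_ex; exists l => A /nbhs_rnorm[e e0 eA].
have e2 : 0 < e / 2 by rewrite divr_gt0.
have [x Fx] := Fb _ e2; apply: (filterS _ (Fx)) => y /(ball_rnorm _ _ (e0c _ e2)) /= xy.
apply: eA; rewrite (le_lt_trans (ler_rnorm_dist _ x _))// [e]splitr ltr_leD//.
exact: Fl Fx.
Qed.

Lemma rcomplete_complete (V : completeNormedModType R[i]) : rcomplete V.
Proof.
move=> P Pex Pd.
(* [P] is not assumed monotone in the error; [Q] is, so the sets [Q e] form a filter base. *)
pose Q (e : R) x := exists2 e', 0 < e' <= e & P e' x.
pose F : set_system V := [set A | exists2 e, 0 < e & Q e `<=` A].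
have FF : ProperFilter F.
  split; first by move=> [e e0]; have [x Px] := Pex _ e0; move/(_ x); apply; exists e => //; rewrite e0/=.
  split; first by exists 1.
    move=> A B [e e0 eA] [e' e0' eB]; exists (Num.min e e'); first by rewrite lt_min e0.
    move=> x [d /andP[d0]]; rewrite le_min => /andP[de de'] Pd'.
    by split; [apply: eA|apply: eB]; exists d => //; rewrite d0.
  by move=> A B AB [e e0 eA]; exists e => //; exact: subset_trans AB.
have : cvg F.
  apply: cauchy_cvg; apply: cauchy_exP => e e0.
  have er : (complex.Re e)%:C%C = e by rewrite RRe_real// gtr0_real.
  have re0 : 0 < complex.Re e by rewrite -ltcR er.
  have e3 : 0 < complex.Re e / 3 by rewrite divr_gt0.
  have [x Px] := Pex _ e3; exists x; exists (complex.Re e / 3) => // y [d /andP[d0 de] Py].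
  apply/(ball_rnorm _ _ e0); rewrite (le_lt_trans (Pd _ _ _ _ d0 e3 Py Px))//.
  lra.
move=> /cvg_ex[l Fl]; exists l => e x e0 Px.
apply: (@ler_addsmall _ _ _ 2) => // d d0.
have : F [set y | rnorm (y - l) < d] by apply: Fl; apply/nbhs_rnorm; exists d.
move=> [e' e'0 Qe'].
have m0 : 0 < Num.min e' d by rewrite lt_min e'0.
have [y Py] := Pex _ m0.
have yd : rnorm (y - l) < d by apply: Qe'; exists (Num.min e' d) => //; rewrite m0/= ge_min lexx.
rewrite (le_trans (ler_rnorm_dist _ y _))//.
have := Pd _ _ _ _ e0 m0 Px Py; have : Num.min e' d <= d by rewrite ge_min lexx orbT.
lra.
Qed.

End completeness.

(** * Bounded operators: pointwise calculus, completeness, composition *)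

Section bop_basics.
Variables (R : realType).

Section one.
Variables (V W : normedModType R[i]).
Implicit Types f g : bop V W.

Lemma bop_ext f g : (forall x, f x = g x) -> f = g.
Proof. by move=> fg; apply/val_inj/funext. Qed.

Lemma bopDE f g x : (f + g) x = f x + g x. Proof. by []. Qed.
Lemma bopNE f x : (- f) x = - f x. Proof. by []. Qed.
Lemma bopBE f g x : (f - g) x = f x - g x. Proof. by []. Qed.
Lemma bopZE l f x : (l *: f) x = l *: f x. Proof. by []. Qed.
Lemma bop0E x : (0 : bop V W) x = 0. Proof. by []. Qed.

Lemma bopD f x y : f (x + y) = f x + f y.
Proof. by have := bop_linear f 1 x y; rewrite !scale1r. Qed.

Lemma bopN f x : f (- x) = - f x.
Proof. by rewrite -scaleN1r bopZ scaleN1r. Qed.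

Lemma rnorm_bopE f : rnorm f = opnorm f. Proof. by []. Qed.

Lemma rnorm_bop f x : rnorm (f x) <= rnorm f * rnorm x.
Proof. exact: opnorm_bound. Qed.

Lemma rnorm_bop_le f (c : R) : 0 <= c -> (forall x, rnorm (f x) <= c * rnorm x) -> rnorm f <= c.
Proof.
by move=> c0 H; apply: opnorm_le => x x1; rewrite (le_trans (H x))// ler_piMr.
Qed.

Lemma bop_exists (g : V -> W) (c : R) : linear g -> (forall x, rnorm (g x) <= c * rnorm x) ->
  exists f : bop V W, forall x, f x = g x.
Proof.
move=> lg cg; have gb : g \in @bounded_linear R V W by apply/asboolP; split=> //; exists c.
by exists (Bop gb).
Qed.

Lemma rcomplete_bop : rcomplete W -> rcomplete (bop V W).
Proof.
move=> cW P Pex Pd.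
(* Values at [u] of the approximants, with the error scaled by [rnorm u]. The pointwise limit then
   keeps the rate [d * rnorm u], which yields its linearity, its boundedness and convergence in
   operator norm. *)
pose Q u (e : R) w := exists f (d : R), [/\ 0 < d, P d f, w = f u & d * rnorm u <= e].
have Qex u (e : R) : 0 < e -> exists w, Q u e w.
  move=> e0; have u1 : 0 < rnorm u + 1 by rewrite ltr_wpDl ?rnorm_ge0.
  have [f Pf] := Pex _ (divr_gt0 e0 u1); exists (f u), f, (e / (rnorm u + 1)).
  split=> //; first exact: divr_gt0.
  by rewrite mulrAC ler_pdivrMr// ler_pM2l// lerDl.
have Qd u (e e' : R) x y : 0 < e -> 0 < e' -> Q u e x -> Q u e' y -> rnorm (x - y) <= e + e'.
  move=> _ _ [f [d [d0 Pf -> de]]] [f' [d' [d'0 Pf' -> de']]].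
  rewrite -bopBE (le_trans (rnorm_bop _ _))//.
  rewrite (le_trans (ler_wpM2r (rnorm_ge0 _) (Pd _ _ _ _ d0 d'0 Pf Pf')))//.
  by rewrite mulrDl lerD.
have /choice[g Hg] : forall u, exists w, forall d f, 0 < d -> P d f ->
    rnorm (f u - w) <= d * rnorm u.
  move=> u; have [w Hw] := cW (Q u) (Qex u) (Qd u).
  exists w => d f d0 Pf; apply: (@ler_addsmall _ _ _ 1) => // e e0; rewrite mulr1.
  apply: Hw; first by rewrite ltr_wpDl// mulr_ge0 ?rnorm_ge0// ltW.
  by exists f, d; split=> //; rewrite lerDl ltW.
have lg : linear g.
  move=> a u v; apply/eqP; rewrite -subr_eq0; apply/eqP/rnorm_eq0/eqP.
  rewrite eq_le rnorm_ge0 andbT.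
  set C := rnorm (a *: u + v) + complex.Re `|a| * rnorm u + rnorm v.
  have C0 : 0 <= C by rewrite !addr_ge0 ?mulr_ge0 ?rnorm_ge0 ?Re_normc_ge0.
  apply: (ler_addsmall C0) => d d0; rewrite add0r.
  have [f Pf] := Pex _ d0.
  have -> : g (a *: u + v) - (a *: g u + g v) =
      - (f (a *: u + v) - g (a *: u + v)) + a *: (f u - g u) + (f v - g v).
    by rewrite bopD bopZ scalerBr opprB -addrA [_ - _ + (f v - g v)]addrACA -opprD subrKA.
  rewrite (le_trans (ler_rnormD _ _))// /C !mulrDr lerD ?Hg//.
  rewrite (le_trans (ler_rnormD _ _))// lerD// ?rnormN ?Hg//.
  by rewrite rnormZ mulrCA ler_wpM2l ?Re_normc_ge0 ?Hg.
have [f1 Pf1] := Pex _ ltr01.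
have [x|h hg] := @bop_exists g (1 + rnorm f1) lg.
  rewrite (le_trans (rnorm_sub_triangle _ (f1 x)))// rnormB mulrDl addrC lerD ?Hg//.
  exact: rnorm_bop.
exists h => e f e0 Pf; apply: rnorm_bop_le => [|x]; first exact: ltW.
by rewrite bopBE hg Hg.
Qed.

End one.

Section comp.
Variables (U V W X : normedModType R[i]).

Lemma bcompE (f : bop V W) (g : bop U V) x : (f \bo g) x = f (g x). Proof. by []. Qed.

Lemma bcompA (f : bop W X) (g : bop V W) (h : bop U V) : f \bo (g \bo h) = f \bo g \bo h.
Proof. exact: bop_ext. Qed.

Lemma bcompDl (f f' : bop V W) (g : bop U V) : (f + f') \bo g = f \bo g + f' \bo g.
Proof. exact: bop_ext. Qed.

Lemma bcompDr (f : bop V W) (g g' : bop U V) : f \bo (g + g') = f \bo g + f \bo g'.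
Proof. by apply: bop_ext => x; rewrite bopDE !bcompE bopDE bopD. Qed.

Lemma bcompZl l (f : bop V W) (g : bop U V) : (l *: f) \bo g = l *: (f \bo g).
Proof. exact: bop_ext. Qed.

Lemma bcompZr l (f : bop V W) (g : bop U V) : f \bo (l *: g) = l *: (f \bo g).
Proof. by apply: bop_ext => x; rewrite bopZE !bcompE bopZE bopZ. Qed.

Lemma bcompNl (f : bop V W) (g : bop U V) : (- f) \bo g = - (f \bo g).
Proof. exact: bop_ext. Qed.

Lemma bcompNr (f : bop V W) (g : bop U V) : f \bo (- g) = - (f \bo g).
Proof. by apply: bop_ext => x; rewrite bopNE !bcompE bopNE bopN. Qed.

Lemma bcompBl (f f' : bop V W) (g : bop U V) : (f - f') \bo g = f \bo g - f' \bo g.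
Proof. by rewrite bcompDl bcompNl. Qed.

Lemma bcompBr (f : bop V W) (g g' : bop U V) : f \bo (g - g') = f \bo g - f \bo g'.
Proof. by rewrite bcompDr bcompNr. Qed.

Lemma bcomp0l (g : bop U V) : (0 : bop V W) \bo g = 0.
Proof. exact: bop_ext. Qed.

Lemma bcomp0r (f : bop V W) : f \bo (0 : bop U V) = 0.
Proof. by apply: bop_ext => x; rewrite bcompE !bop0E bop0. Qed.

Lemma bcomp_suml (I : Type) (s : seq I) (F : I -> bop V W) (g : bop U V) :
  (\sum_(i <- s) F i) \bo g = \sum_(i <- s) (F i \bo g).
Proof. by elim: s => [|i s IH]; rewrite ?big_nil ?bcomp0l// !big_cons bcompDl IH. Qed.

Lemma bcomp_sumr (I : Type) (s : seq I) (f : bop V W) (F : I -> bop U V) :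
  f \bo (\sum_(i <- s) F i) = \sum_(i <- s) (f \bo F i).
Proof. by elim: s => [|i s IH]; rewrite ?big_nil ?bcomp0r// !big_cons bcompDr IH. Qed.

Lemma rnorm_bcomp (f : bop V W) (g : bop U V) : rnorm (f \bo g) <= rnorm f * rnorm g.
Proof.
apply: rnorm_bop_le => [|x]; first by rewrite mulr_ge0 ?rnorm_ge0.
rewrite bcompE (le_trans (rnorm_bop _ _))// -mulrA.
by rewrite ler_wpM2l ?rnorm_ge0// rnorm_bop.
Qed.

End comp.

End bop_basics.

(** * The real inner product and the Riesz representation *)

Section hilbert.
Variable (R : realType).

Lemma ReD (a b : R[i]) : complex.Re (a + b) = complex.Re a + complex.Re b.
Proof. by case: a b => ? ? []. Qed.

Lemma ReJ (a : R[i]) : complex.Re (a^*) = complex.Re a.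
Proof. by case: a. Qed.

Lemma Re_realM (r : R) (a : R[i]) : complex.Re (r%:C%C * a) = r * complex.Re a.
Proof. by case: a => x y /=; rewrite mul0r subr0. Qed.

Lemma eq_Re_scale (a b : R[i]) :
  (forall l : R[i], complex.Re (l * a) = complex.Re (l * b)) -> a = b.
Proof.
move=> H; have := H 1; have := H 'i%C; rewrite !mul1r.
case: a b {H} => [x y] [x' y'] /=; rewrite !mul0r !mul1r !sub0r.
by move=> /oppr_inj -> ->.
Qed.

Variable (H : hilbertType R).
Implicit Types x y z : H.

Lemma innerDl x y z : inner (x + y) z = inner x z + inner y z.
Proof. by have := inner_linear z 1 x y; rewrite scale1r mul1r. Qed.

Lemma inner0l z : inner 0 z = 0.
Proof. by apply/(addrI (inner 0 z)); rewrite -innerDl !addr0. Qed.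

Lemma innerZl l x z : inner (l *: x) z = l * inner x z.
Proof. by have := inner_linear z l x 0; rewrite inner0l !addr0. Qed.

Lemma innerDr x y z : inner x (y + z) = inner x y + inner x z.
Proof. by rewrite inner_conj innerDl rmorphD [inner x y]inner_conj [inner x z]inner_conj. Qed.

Lemma innerZr l x z : inner x (l *: z) = l^* * inner x z.
Proof. by rewrite inner_conj innerZl rmorphM [inner x z]inner_conj. Qed.

(** Real parts make the squared norm of [x + t y] a real quadratic in [t]. Nothing is lost, because
    the real parts of all complex multiples determine a complex number ([eq_Re_scale]). *)
Definition rinner x y : R := complex.Re (inner x y).

Lemma rinnerC x y : rinner x y = rinner y x.
Proof. by rewrite /rinner inner_conj ReJ. Qed.

Lemma rinnerDl x y z : rinner (x + y) z = rinner x z + rinner y z.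
Proof. by rewrite /rinner innerDl ReD. Qed.

Lemma rinnerDr x y z : rinner x (y + z) = rinner x y + rinner x z.
Proof. by rewrite /rinner innerDr ReD. Qed.

Lemma rinnerZl (r : R) x y : rinner (r%:C%C *: x) y = r * rinner x y.
Proof. by rewrite /rinner innerZl Re_realM. Qed.

Lemma rinnerZr (r : R) x y : rinner x (r%:C%C *: y) = r * rinner x y.
Proof. by rewrite rinnerC rinnerZl rinnerC. Qed.

Lemma rinner_norm x : rinner x x = rnorm x ^+ 2.
Proof. by rewrite /rinner inner_norm -rnormE -rmorphXn. Qed.

Lemma rinnerNl x y : rinner (- x) y = - rinner x y.
Proof. by rewrite -scaleN1r -[-1](rmorphN1 (real_complex R)) rinnerZl mulN1r. Qed.

Lemma rinnerNr x y : rinner x (- y) = - rinner x y.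
Proof. by rewrite rinnerC rinnerNl rinnerC. Qed.

Lemma rnormD_sqr x y (t : R) :
  rnorm (x + t%:C%C *: y) ^+ 2 = rnorm x ^+ 2 + 2 * t * rinner x y + t ^+ 2 * rnorm y ^+ 2.
Proof.
rewrite -!rinner_norm rinnerDl !rinnerDr !rinnerZl !rinnerZr (rinnerC y x); ring.
Qed.

Lemma rinner_le x y : `|rinner x y| <= rnorm x * rnorm y.
Proof.
rewrite -(@ler_pXn2r _ 2) ?nnegrE ?mulr_ge0 ?rnorm_ge0// exprMn real_normK ?num_real//.
by apply: sqr_le_discr => t; rewrite -rnormD_sqr sqr_ge0.
Qed.

Lemma eq_inner x y : (forall z, rinner z x = rinner z y) -> x = y.
Proof.
move=> E; apply/eqP; rewrite -subr_eq0; apply/eqP/rnorm_eq0/eqP.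
by rewrite -sqrf_eq0 -rinner_norm rinnerDr rinnerNr E subrr.
Qed.

(* Minimize |x|^2 - 2 Re (phi x): by the parallelogram law minimizing sequences
   are Cauchy, and the derivative at the minimum gives the representation. *)
Lemma riesz (phi : H -> R[i]) (c : R) :
  (forall x y, phi (x + y) = phi x + phi y) -> (forall l x, phi (l *: x) = l * phi x) ->
  (forall x, complex.Re (phi x) <= c * rnorm x) ->
  exists s, forall x, phi x = inner x s.
Proof.
move=> phiD phiZ phic.
pose f x := complex.Re (phi x).
have fD x y : f (x + y) = f x + f y by rewrite /f phiD ReD.
have fZ (r : R) x : f (r%:C%C *: x) = r * f x by rewrite /f phiZ Re_realM.
pose J x := rnorm x ^+ 2 - 2 * f x.
pose E := [set J x | x in [set: H]].
have hE : has_inf E.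
  split; first by exists (J 0), 0.
  exists (- (c ^+ 2)) => _ [x _ <-]; rewrite /J.
  by have := phic x; rewrite -/(f x); have := sqr_ge0 (rnorm x - c); nra.
pose m := inf E.
have mJ x : m <= J x by apply: (ge_inf hE.2); exists x.
(* The tolerance fits the parallelogram law: |x - y|^2 <= 2 (J x - m) + 2 (J y - m) < e^2 + e'^2 <=
   (e + e')^2. *)
pose P (e : R) x := J x < m + e ^+ 2 / 2.
have Pex (e : R) : 0 < e -> exists x, P e x.
  move=> e0; have e2 : 0 < e ^+ 2 / 2 by rewrite divr_gt0// exprn_gt0.
  by have [_ [x _ <-] xm] := inf_adherent e2 hE; exists x.
have Pd (e e' : R) x y : 0 < e -> 0 < e' -> P e x -> P e' y -> rnorm (x - y) <= e + e'.
  move=> e0 e'0; rewrite /P => Px Py.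
  have := mJ (2^-1%:C%C *: x + 2^-1%:C%C *: y).
  rewrite /J rnormD_sqr fD !fZ rnormZr ger0_norm// rinnerZl => mm.
  rewrite -(@ler_pXn2r _ 2) ?nnegrE ?rnorm_ge0 ?addr_ge0 ?(ltW e0) ?(ltW e'0)//.
  have -> : x - y = x + (-1)%:C%C *: y by rewrite rmorphN1 scaleN1r.
  rewrite rnormD_sqr.
  move: mm Px Py; rewrite /J; nra.
have [s Ps] := rcomplete_complete Pex Pd.
(* Approximate minimizers suffice: [J (x + t v) - m] is a nonnegative quadratic in [t], and its
   discriminant bounds the defect of the representation at [v]. *)
have opt x (e : R) v : 0 < e -> P e x -> `|rinner v x - f v| <= e * rnorm v.
  move=> e0 Px; rewrite -(@ler_pXn2r _ 2) ?nnegrE ?mulr_ge0 ?rnorm_ge0 ?(ltW e0)//.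
  rewrite real_normK ?num_real// exprMn.
  apply: sqr_le_discr => t; have := mJ (x + t%:C%C *: v).
  rewrite /J rnormD_sqr fD fZ (rinnerC v x) => mm.
  move: Px; rewrite /P /J; have := exprn_gt0 2 e0; lra.
have fs v : f v = rinner v s.
  apply/eqP; rewrite eq_sym -subr_eq0 -normr_eq0 eq_le normr_ge0 andbT.
  apply: (@ler_addsmall _ _ _ (2 * rnorm v)); rewrite ?mulr_ge0 ?rnorm_ge0// => e e0.
  have [x Px] := Pex _ e0; have := opt _ _ v e0 Px.
  have -> : rinner v s - f v = (rinner v x - f v) - rinner v (x - s).
    by rewrite rinnerDr rinnerNr; ring.
  have := rinner_le v (x - s); have := Ps _ _ e0 Px.
  move=> xs vs oo; rewrite (le_trans (ler_normB _ _))// add0r mulrCA [leRHS]mulrDl mul1r lerD//.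
  by rewrite (le_trans vs)// mulrC ler_wpM2r ?rnorm_ge0.
exists s => x; apply: eq_Re_scale => l.
by rewrite -phiZ -innerZl; exact: fs.
Qed.

End hilbert.

(** * Adjoints and the C*-identity *)

Section adjoint.
Variable (R : realType).
Implicit Types H K L : hilbertType R.

(** Riesz gives the adjoint pointwise, and |S y|^2 = Re <T (S y), y> bounds it. Since [adj] is
    picked by choice, this existence proof is what makes its defining identity available. *)
Lemma adj_inner H K (T : bop H K) x y : inner (T x) y = inner x (adj T y).
Proof.
have /choice[g Hg] : forall y, exists s, forall x, inner (T x) y = inner x s.
  move=> {}y; apply: (@riesz _ _ (fun x => inner (T x) y) (rnorm T * rnorm y)).
  - by move=> u v; rewrite bopD innerDl.
  - by move=> l u; rewrite bopZ innerZl.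
  - move=> u; rewrite (le_trans (ler_norm _))// (le_trans (rinner_le _ _))//.
    by rewrite mulrAC ler_wpM2r ?rnorm_ge0// rnorm_bop.
have gT z u : rinner z (g u) = rinner (T z) u by rewrite /rinner -Hg.
have lg : linear g.
  move=> a u v; apply: eq_inner => z.
  by rewrite /rinner -Hg !innerDr !innerZr -!Hg.
have [x'|S HS] := @bop_exists _ _ _ g (rnorm T) lg.
  have [->|g0] := eqVneq (g x') 0; first by rewrite rnorm0 mulr_ge0 ?rnorm_ge0.
  rewrite -(ler_pM2l (rnorm_gt0 g0)) -expr2 -rinner_norm gT.
  rewrite (le_trans (ler_norm _))// (le_trans (rinner_le _ _))//.
  by rewrite mulrA ler_wpM2r ?rnorm_ge0// mulrC rnorm_bop.
rewrite /adj.
have := @xgetPex _ 0 [set S : bop K H | forall x y, inner (T x) y = inner x (S y)].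
by move=> /(_ _)/=; apply; exists S => u v; rewrite Hg HS.
Qed.

Lemma adj_rinner H K (T : bop H K) x y : rinner (T x) y = rinner x (adj T y).
Proof. by rewrite /rinner adj_inner. Qed.

Lemma adj_uniq H K (T : bop H K) (S : bop K H) :
  (forall x y, rinner (T x) y = rinner x (S y)) -> adj T = S.
Proof. by move=> E; apply: bop_ext => y; apply: eq_inner => z; rewrite -adj_rinner E. Qed.

Lemma adjK H K (T : bop H K) : adj (adj T) = T.
Proof. by apply: adj_uniq => x y; rewrite rinnerC -adj_rinner rinnerC. Qed.

Lemma adjD H K (T S : bop H K) : adj (T + S) = adj T + adj S.
Proof.
by apply: adj_uniq => x y; rewrite !bopDE rinnerDl rinnerDr !adj_rinner.
Qed.

Lemma adjZ H K l (T : bop H K) : adj (l *: T) = l^* *: adj T.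
Proof.
apply: adj_uniq => x y; rewrite !bopZE /rinner innerZl innerZr conjCK.
by rewrite adj_inner.
Qed.

Lemma adjN H K (T : bop H K) : adj (- T) = - adj T.
Proof. by rewrite -scaleN1r adjZ rmorphN1 scaleN1r. Qed.

Lemma adjB H K (T S : bop H K) : adj (T - S) = adj T - adj S.
Proof. by rewrite adjD adjN. Qed.

Lemma adj0 H K : adj (0 : bop H K) = 0.
Proof. by rewrite -{1}(subrr 0) adjB subrr. Qed.

Lemma adj_comp H K L (T : bop K L) (S : bop H K) : adj (T \bo S) = adj S \bo adj T.
Proof. by apply: adj_uniq => x y; rewrite !bcompE !adj_rinner. Qed.

Lemma adj_sum H K (I : Type) (s : seq I) (F : I -> bop H K) :
  adj (\sum_(i <- s) F i) = \sum_(i <- s) adj (F i).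
Proof. by elim: s => [|i s IH]; rewrite ?big_nil ?adj0// !big_cons adjD IH. Qed.

Lemma rnorm_adj_comp_ge H K (T : bop H K) : rnorm T ^+ 2 <= rnorm (adj T \bo T).
Proof.
have N0 := rnorm_ge0 (adj T \bo T).
rewrite -[leRHS]sqr_sqrtr// lerXn2r ?nnegrE ?rnorm_ge0 ?sqrtr_ge0//.
apply: rnorm_bop_le => [|x]; first exact: sqrtr_ge0.
rewrite -(@ler_pXn2r _ 2) ?nnegrE ?mulr_ge0 ?rnorm_ge0 ?sqrtr_ge0//.
rewrite exprMn sqr_sqrtr// -rinner_norm adj_rinner.
rewrite (le_trans (ler_norm _))// (le_trans (rinner_le _ _))// mulrC expr2 mulrA.
by rewrite ler_wpM2r ?rnorm_ge0// -bcompE rnorm_bop.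
Qed.

(** From |S|^2 <= |S^* S| <= |S^*| |S|, applied to [T] and to its adjoint. *)
Lemma rnorm_adj H K (T : bop H K) : rnorm (adj T) = rnorm T.
Proof.
have key H' K' (S : bop H' K') : rnorm S <= rnorm (adj S).
  have [->|S0] := eqVneq S 0; first by rewrite rnorm0 rnorm_ge0.
  rewrite -(ler_pM2r (rnorm_gt0 S0)) -expr2.
  exact: le_trans (rnorm_adj_comp_ge _) (rnorm_bcomp _ _).
by apply/eqP; rewrite eq_le key -{2}[T]adjK key.
Qed.

Lemma rnorm_adj_comp H K (T : bop H K) : rnorm (adj T \bo T) = rnorm T ^+ 2.
Proof.
apply/eqP; rewrite eq_le rnorm_adj_comp_ge andbT (le_trans (rnorm_bcomp _ _))//.
by rewrite rnorm_adj expr2.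
Qed.

End adjoint.

(** * Block operators, continuity of operations, and the twisted product *)

Section blocks.
Variables (R : realType).

Section entries.
Variables (V W : normedModType R[i]).
Implicit Types (a : bop V V) (b : bop W V) (c : bop V W) (d : bop W W).
Implicit Types T : bop (l2sum V W) (l2sum V W).

Lemma block11K a b c d : block11 (block a b c d) = a.
Proof.
apply: bop_ext => x; rewrite /block11 !bcompE blockE /=.
by rewrite [X in _ + X](_ : _ = 0) ?addr0//; exact: bop0.
Qed.

Lemma block12K a b c d : block12 (block a b c d) = b.
Proof.
apply: bop_ext => x; rewrite /block12 !bcompE blockE /=.
by rewrite [X in X + _](_ : _ = 0) ?add0r//; exact: bop0.
Qed.

Lemma block21K a b c d : block21 (block a b c d) = c.
Proof.
apply: bop_ext => x; rewrite /block21 !bcompE blockE /=.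
by rewrite [X in _ + X](_ : _ = 0) ?addr0//; exact: bop0.
Qed.

Lemma block22K a b c d : block22 (block a b c d) = d.
Proof.
apply: bop_ext => x; rewrite /block22 !bcompE blockE /=.
by rewrite [X in X + _](_ : _ = 0) ?add0r//; exact: bop0.
Qed.

Lemma block_eta T : T = block (block11 T) (block12 T) (block21 T) (block22 T).
Proof.
apply: bop_ext => p; rewrite blockE !bcompE -!bopD.
have -> : inj1 V W p.1 + inj2 V W p.2 = p.
  by case: p => x y; congr pair; rewrite /= ?addr0 ?add0r.
exact: surjective_pairing.
Qed.

Lemma block_inj a b c d a' b' c' d' : block a b c d = block a' b' c' d' ->
  [/\ a = a', b = b', c = c' & d = d'].
Proof.
move=> E; split.
- by rewrite -[LHS](block11K _ b c d) E block11K.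
- by rewrite -[LHS](block12K a _ c d) E block12K.
- by rewrite -[LHS](block21K a b _ d) E block21K.
- by rewrite -[LHS](block22K a b c) E block22K.
Qed.

Lemma blockD a b c d a' b' c' d' : block a b c d + block a' b' c' d' =
  block (a + a') (b + b') (c + c') (d + d').
Proof.
by apply: bop_ext => p; rewrite bopDE !blockE; congr pair; exact: addrACA.
Qed.

Lemma blockZ l a b c d : l *: block a b c d = block (l *: a) (l *: b) (l *: c) (l *: d).
Proof.
by apply: bop_ext => p; rewrite bopZE !blockE; congr pair; exact: scalerDr.
Qed.

Lemma block0 : block 0 0 0 0 = 0 :> bop (l2sum V W) (l2sum V W).
Proof. by apply: bop_ext => p; rewrite blockE !bop0E !addr0. Qed.

Lemma block_comp a b c d a' b' c' d' : block a b c d \bo block a' b' c' d' =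
  block (a \bo a' + b \bo c') (a \bo b' + b \bo d') (c \bo a' + d \bo c') (c \bo b' + d \bo d').
Proof.
by apply: bop_ext => p; rewrite bcompE !blockE; rewrite !bopD;
  congr pair; exact: addrACA.
Qed.

Lemma block_lin l a b c d a' b' c' d' : l *: block a b c d + block a' b' c' d' =
  block (l *: a + a') (l *: b + b') (l *: c + c') (l *: d + d').
Proof. by rewrite blockZ blockD. Qed.

Lemma rnorm_block11 T : rnorm (block11 T) <= rnorm T.
Proof.
apply: rnorm_bop_le => [|x]; first exact: rnorm_ge0.
rewrite (le_trans (rnorm_fst _))// (le_trans (rnorm_bop _ _))//.
by rewrite ler_wpM2l ?rnorm_ge0// rnorm_l2sum/= rnorm0 /l2norm expr0n addr0 sqrtr_sqr ger0_norm ?rnorm_ge0.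
Qed.

Lemma rnorm_block12 T : rnorm (block12 T) <= rnorm T.
Proof.
apply: rnorm_bop_le => [|x]; first exact: rnorm_ge0.
rewrite (le_trans (rnorm_fst _))// (le_trans (rnorm_bop _ _))//.
by rewrite ler_wpM2l ?rnorm_ge0// rnorm_l2sum/= rnorm0 /l2norm expr0n add0r sqrtr_sqr ger0_norm ?rnorm_ge0.
Qed.

Lemma rnorm_block21 T : rnorm (block21 T) <= rnorm T.
Proof.
apply: rnorm_bop_le => [|x]; first exact: rnorm_ge0.
rewrite (le_trans (rnorm_snd _))// (le_trans (rnorm_bop _ _))//.
by rewrite ler_wpM2l ?rnorm_ge0// rnorm_l2sum/= rnorm0 /l2norm expr0n addr0 sqrtr_sqr ger0_norm ?rnorm_ge0.
Qed.

Lemma rnorm_block22 T : rnorm (block22 T) <= rnorm T.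
Proof.
apply: rnorm_bop_le => [|x]; first exact: rnorm_ge0.
rewrite (le_trans (rnorm_snd _))// (le_trans (rnorm_bop _ _))//.
by rewrite ler_wpM2l ?rnorm_ge0// rnorm_l2sum/= rnorm0 /l2norm expr0n add0r sqrtr_sqr ger0_norm ?rnorm_ge0.
Qed.

Lemma l2norm_le (x y : R) : 0 <= x -> 0 <= y -> l2norm x y <= x + y.
Proof.
move=> x0 y0; rewrite -[leRHS]ger0_norm ?addr_ge0// -sqrtr_sqr ler_wsqrtr//.
by rewrite sqrrD addrAC lerDl mulrn_wge0 ?mulr_ge0.
Qed.

Lemma rnorm_block_le a b c d :
  rnorm (block a b c d) <= rnorm a + rnorm b + rnorm c + rnorm d.
Proof.
apply: rnorm_bop_le => [|p]; first by rewrite !addr_ge0 ?rnorm_ge0.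
rewrite blockE rnorm_l2sum/= (le_trans (l2norm_le _ _)) ?rnorm_ge0//.
rewrite (le_trans (lerD (ler_rnormD _ _) (ler_rnormD _ _)))// addrA !mulrDl.
by rewrite !lerD// (le_trans (rnorm_bop _ _))// ler_wpM2l ?rnorm_ge0 ?rnorm_fst ?rnorm_snd.
Qed.

End entries.

Section continuity.
Context {T : Type} {F : set_system T} {FF : Filter F}.

Lemma cvg_rnormP (V : normedModType R[i]) (f : T -> V) (l : V) :
  (forall e : R, 0 < e -> F [set x | rnorm (f x - l) < e]) <-> f @ F --> l.
Proof.
split=> [H A /nbhs_rnorm[e e0 eA]|fl e e0].
  rewrite /= nbhs_simpl /=; apply: (filterS _ (H e e0)) => x /= xl.
  exact: eA.
by apply: (fl [set y | rnorm (y - l) < e]); apply/nbhs_rnorm; exists e.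
Qed.

Lemma cvg_bcomp (U V W : normedModType R[i]) (f : T -> bop V W) (g : T -> bop U V) a b :
  f @ F --> a -> g @ F --> b -> (fun x => f x \bo g x) @ F --> a \bo b.
Proof.
move=> /cvg_rnormP fa /cvg_rnormP gb; apply/cvg_rnormP => e e0.
have C0 : 0 < rnorm a + rnorm b + 2 by rewrite ltr_wpDl ?addr_ge0 ?rnorm_ge0.
(* The bound 1 gives |g x| <= |b| + 1, so the total error is at most d (|a| + |b| + 1); the 2 in the
   denominator makes this strictly smaller than [e]. *)
pose d := Num.min 1 (e / (rnorm a + rnorm b + 2)).
have d0 : 0 < d by rewrite lt_min ltr01 divr_gt0.
apply: (filterS _ (filterI (fa d d0) (gb d d0))) => x /= [fx gx].
have d1 : d <= 1 by rewrite ge_min lexx.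
have de : d * (rnorm a + rnorm b + 2) <= e.
  by rewrite -ler_pdivlMr// ge_min lexx orbT.
have -> : f x \bo g x - a \bo b = (f x - a) \bo g x + a \bo (g x - b).
  by rewrite bcompBl bcompBr subrKA.
have := rnorm_sub_triangle (g x) b.
have := rnorm_bcomp (f x - a) (g x); have := rnorm_bcomp a (g x - b).
have := ler_rnormD ((f x - a) \bo g x) (a \bo (g x - b)).
have := rnorm_ge0 (f x - a); have := rnorm_ge0 (g x - b); have := rnorm_ge0 (g x).
have := rnorm_ge0 a; have := rnorm_ge0 b.
move: (rnorm (_ + _)) (rnorm (_ \bo g x)) (rnorm (a \bo _)) => A B C *.
have : rnorm (f x - a) * rnorm (g x) <= d * (rnorm b + 1).
  by rewrite ler_pM// ?ltW//; lra.
have : rnorm a * rnorm (g x - b) <= rnorm a * d by rewrite ler_wpM2l// ltW.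
lra.
Qed.

Lemma cvg_adj (H K : hilbertType R) (f : T -> bop H K) a :
  f @ F --> a -> (fun x => adj (f x)) @ F --> adj a.
Proof.
move=> /cvg_rnormP fa; apply/cvg_rnormP => e e0; apply: (filterS _ (fa e e0)) => x /=.
by rewrite -adjB rnorm_adj.
Qed.

Lemma cvg_block (V W : normedModType R[i]) (f1 : T -> bop V V) f2 f3 (f4 : T -> bop W W)
    a b c d :
  f1 @ F --> a -> f2 @ F --> b -> f3 @ F --> c -> f4 @ F --> d ->
  (fun x => block (f1 x) (f2 x) (f3 x) (f4 x)) @ F --> block a b c d.
Proof.
move=> fa fb fc fd.
by do 3?[apply: cvgD]; do !apply: cvg_bcomp => //; apply: cvg_cst.
Qed.

End continuity.

Section block_algebra.
Variables (H K : hilbertType R).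
Implicit Types (T : bop (l2sum K H) (l2sum K H)).

Lemma block_mulE (a a' : bop K K) z z' c c' (b b' : bop H H) :
  block_mul (block a z c b) (block a' z' c' b') =
  block (- (a \bo a') + z \bo c') (- (a \bo z') - z \bo b')
        (- (c \bo a') - b \bo c') (c \bo z' - b \bo b').
Proof. by rewrite /block_mul !(block11K, block12K, block21K, block22K). Qed.

Lemma block_starE (a : bop K K) z c (b : bop H H) :
  block_star (block a z c b) = block (adj a) (adj c) (adj z) (adj b).
Proof. by rewrite /block_star !(block11K, block12K, block21K, block22K). Qed.

(* Twisting the entries by signs and by [i] turns [block_mul] into composition. *)
Definition block_twist T : bop (l2sum K H) (l2sum K H) :=
  block (- block11 T) ('i%C *: block12 T) ('i%C *: block21 T) (- block22 T).

Lemma block_twistE (a : bop K K) z c (b : bop H H) :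
  block_twist (block a z c b) = block (- a) ('i%C *: z) ('i%C *: c) (- b).
Proof. by rewrite /block_twist !(block11K, block12K, block21K, block22K). Qed.

Lemma block_twist_inj : injective block_twist.
Proof.
have i0 : 'i%C != 0 :> R[i] by rewrite eq_complex /= oner_eq0 andbF.
move=> T T' /block_inj[/oppr_inj e1 /(scalerI i0) e2 /(scalerI i0) e3 /oppr_inj e4].
by rewrite [T]block_eta [T']block_eta e1 e2 e3 e4.
Qed.

Lemma block_twist_lin l T T' :
  block_twist (l *: T + T') = l *: block_twist T + block_twist T'.
Proof.
rewrite [T]block_eta [T']block_eta block_lin !block_twistE block_lin.
by rewrite !opprD !scalerDr !scalerN !scalerA ![l * _]mulrC.
Qed.

Lemma block_twistM T T' : block_twist (block_mul T T') = block_twist T \bo block_twist T'.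
Proof.
rewrite [T]block_eta [T']block_eta block_mulE !block_twistE block_comp.
rewrite !(bcompZl, bcompZr) !(bcompNl, bcompNr) !scalerA -expr2 sqr_i !scaleN1r opprK.
by rewrite !opprD !opprK !scalerDr !scalerN.
Qed.

Lemma block_mulA T1 T2 T3 :
  block_mul T1 (block_mul T2 T3) = block_mul (block_mul T1 T2) T3.
Proof. by apply: block_twist_inj; rewrite !block_twistM bcompA. Qed.

Lemma block_mul_linl l T1 T2 T3 :
  block_mul (l *: T1 + T2) T3 = l *: block_mul T1 T3 + block_mul T2 T3.
Proof.
apply: block_twist_inj.
by rewrite !(block_twistM, block_twist_lin) bcompDl bcompZl.
Qed.

Lemma block_mul_linr l T1 T2 T3 :
  block_mul T3 (l *: T1 + T2) = l *: block_mul T3 T1 + block_mul T3 T2.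
Proof.
apply: block_twist_inj.
by rewrite !(block_twistM, block_twist_lin) bcompDr bcompZr.
Qed.

Lemma block_star_lin l T1 T2 :
  block_star (l *: T1 + T2) = l^* *: block_star T1 + block_star T2.
Proof.
by rewrite [T1]block_eta [T2]block_eta block_lin !block_starE block_lin !adjD !adjZ.
Qed.

(** Checked on the entries: the twist does not carry [block_star] to the adjoint, because the
    conjugate of $i$ is $-i$. *)
Lemma block_starM T1 T2 :
  block_star (block_mul T1 T2) = block_mul (block_star T2) (block_star T1).
Proof.
rewrite [T1]block_eta [T2]block_eta block_mulE !block_starE block_mulE.
by rewrite !adjD !adjN !adj_comp.
Qed.

Lemma block_starK T : block_star (block_star T) = T.
Proof. by rewrite [T]block_eta !block_starE !adjK. Qed.

Lemma continuous_block_mul :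
  continuous (fun p : bop (l2sum K H) (l2sum K H) * bop (l2sum K H) (l2sum K H) =>
    block_mul p.1 p.2).
Proof.
case=> S S'; rewrite /continuous_at.
have c1 : x.1 @[x --> (S, S')] --> S by exact: cvg_fst.
have c2 : x.2 @[x --> (S, S')] --> S' by exact: cvg_snd.
have cb (E F : normedModType R[i]) (u : bop (l2sum K H) E) (v : bop F (l2sum K H)) :
    (u \bo x.1 \bo v) @[x --> (S, S')] --> u \bo S \bo v /\
    (u \bo x.2 \bo v) @[x --> (S, S')] --> u \bo S' \bo v.
  by split; do 2?apply: cvg_bcomp => //; exact: cvg_cst.
apply: cvg_block; (apply: cvgD; [|try apply: cvgN]; try apply: cvgN);
  by apply: cvg_bcomp; [exact: (cb _ _ _ _).1|exact: (cb _ _ _ _).2].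
Qed.

Lemma continuous_block_star : continuous (@block_star R H K).
Proof.
move=> p; rewrite /continuous_at.
apply: (@cvg_block _ (nbhs p) _); apply: (@cvg_adj _ (nbhs p) _); apply: cvg_bcomp; (try exact: cvg_cst);
  by apply: cvg_bcomp; [exact: cvg_cst|exact: cvg_id].
Qed.

End block_algebra.
End blocks.

(** * The TRO, its dual, and operators in the span of $VV^*$ *)

Section tro_theory.
Variables (R : realType) (H K : hilbertType R) (V : tro H K).
Implicit Types x y z f g : tro_sort V.

Lemma tro_lin l x y : l *: tro_val x + tro_val y \in tro_set V.
Proof. exact: tro_mem (l *: x + y). Qed.

Lemma tro_valD x y : tro_val (x + y) = tro_val x + tro_val y. Proof. by []. Qed.
Lemma tro_valB x y : tro_val (x - y) = tro_val x - tro_val y. Proof. by []. Qed.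
Lemma tro_valZ l x : tro_val (l *: x) = l *: tro_val x. Proof. by []. Qed.
Lemma tro_val0 : tro_val (0 : tro_sort V) = 0. Proof. by []. Qed.

Lemma tro_val_inj x y : tro_val x = tro_val y -> x = y.
Proof. exact: val_inj. Qed.

Lemma rnorm_tro x : rnorm x = rnorm (tro_val x). Proof. by []. Qed.

Lemma tro_ncl : ncl [set` tro_set V] `<=` [set` tro_set V].
Proof. by rewrite -closure_ncl -(iffLR (closure_id _) (@tro_closed _ _ _ V)). Qed.

Lemma rcomplete_tro : rcomplete (tro_sort V).
Proof.
move=> P Pex Pd.
pose Q e (T : bop H K) := exists2 x, tro_val x = T & P e x.
have [e e0|e e' _ _ e0 e'0 [x <- Px] [y <- Py]|l Ql] :=
    @rcomplete_bop _ H K (@rcomplete_complete _ K) Q.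
- by have [x Px] := Pex _ e0; exists (tro_val x), x.
- by rewrite -tro_valB -rnorm_tro Pd.
have lV : l \in tro_set V.
  apply: tro_ncl => e e0; have e2 : 0 < e / 2 by rewrite divr_gt0.
  have [x Px] := Pex _ e2; exists (tro_val x); first exact: tro_mem.
  by rewrite (le_lt_trans (Ql _ _ e2 _))//; [exists x|lra].
exists (TroElt lV) => e x e0 Px; rewrite rnorm_tro tro_valB.
by apply: Ql => //; exists x.
Qed.

(** Since $x^*x$ is self-adjoint, |x|^4 = |x^* x|^2 = |x^* x x^* x| <= |x| |x x^* x|; then cancel
    |x|. *)
Lemma rnorm_tro3 x : rnorm (x \bo adj x \bo x) = rnorm x ^+ 3.
Proof.
rewrite rnorm_tro; apply/eqP; rewrite eq_le; apply/andP; split.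
  rewrite (le_trans (rnorm_bcomp _ _))// !exprSr expr0 mul1r.
  by rewrite ler_wpM2r ?rnorm_ge0// (le_trans (rnorm_bcomp _ _))// rnorm_adj.
have [/eqP ->|x0] := boolP (rnorm (tro_val x) == 0); first by rewrite expr0n rnorm_ge0.
have x1 : 0 < rnorm (tro_val x) by rewrite lt_neqAle eq_sym x0 rnorm_ge0.
rewrite -(ler_pM2l x1) -exprS (_ : (3.+1 = 2 * 2)%N)// exprM -rnorm_adj_comp.
have sa : adj (adj x \bo x) = adj x \bo x by rewrite adj_comp adjK.
rewrite -rnorm_adj_comp sa bcompA -[adj x \bo x \bo adj x]bcompA -bcompA.
by rewrite -[X in _ <= X * _]rnorm_adj -!bcompA rnorm_bcomp.
Qed.

Lemma anti_triple_cstar : cstar_ternary_ring (@anti_triple R H K V).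
Proof.
have cnorm (a b : R) (A B : R[i]) : A = a%:C%C -> B = b%:C%C -> a <= b -> A <= B.
  by move=> -> ->; rewrite lecR.
split.
- split=> *; apply: tro_val_inj; rewrite /= ?(bcompDl, bcompZl, adjD, adjZ, bcompDr, bcompZr).
  + by rewrite opprD scalerN.
  + by rewrite opprD scalerN.
  + by rewrite opprD scalerN.
  + by rewrite !(bcompNl, bcompNr, adjN) !adj_comp adjK !bcompA.
  + by rewrite !(bcompNl, bcompNr, adjN) !bcompA.
- exact: cauchy_cvg_rcomplete rcomplete_tro.
- move=> x y z; rewrite -!rnormE -!rmorphM lecR !rnorm_tro /= rnormN.
  rewrite (le_trans (rnorm_bcomp _ _))// ler_wpM2r ?rnorm_ge0//.
  by rewrite (le_trans (rnorm_bcomp _ _))// rnorm_adj.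
- by move=> x; rewrite -!rnormE -rmorphXn rnorm_tro /= rnormN rnorm_tro3.
Qed.

Lemma tro_dual_submod : submod_closed [pred T : bop K H | adj T \in tro_set V].
Proof.
split; first by rewrite inE adj0; have [] := tro_submod V.
move=> l T T'; rewrite !inE adjD adjZ => h h'.
exact: (tro_lin _ (TroElt h) (TroElt h')).
Qed.

Lemma tro_dual_closed : closed [set` [pred T : bop K H | adj T \in tro_set V]].
Proof.
apply/closure_id; rewrite closure_ncl; apply/seteqP; split; first exact: sub_ncl.
move=> T Tc; apply: tro_ncl.
apply: (@ncl_map _ _ _ _ [set` tro_set V] (@adj R K H) 1 _ _ T Tc) => [S S'|S SV].
  by rewrite -adjB rnorm_adj mul1r.
exact: sub_ncl.
Qed.

Lemma tro_dual_triple : let W := [pred T : bop K H | adj T \in tro_set V] in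
  forall x y z : bop K H, x \in W -> y \in W -> z \in W -> x \bo adj y \bo z \in W.
Proof.
move=> W x y z; rewrite !inE => hx hy hz.
by rewrite !adj_comp bcompA -[in X in _ \bo X \bo _](adjK y) adjK tro_triple.
Qed.

(** The TRO $V^*$, encoded as a preimage under [adj], so that membership in both directions reduces
    to [adjK]. *)
Definition tro_dual : tro K H := Tro tro_dual_submod tro_dual_closed tro_dual_triple.

Lemma tro_adj_mem x : adj (tro_val x) \in tro_set tro_dual.
Proof. by rewrite inE/= adjK tro_mem. Qed.

Definition tro_adj x : tro_sort tro_dual := TroElt (tro_adj_mem x).

Lemma tro_dual_mem (x : tro_sort tro_dual) : adj (tro_val x) \in tro_set V.
Proof. exact: tro_mem x. Qed.

Definition tro_unadj (x : tro_sort tro_dual) : tro_sort V := TroElt (tro_dual_mem x).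

(** Carries the facts about sums of $xy^*$ over to sums of $u^*v$: after taking adjoints, right
    multiplication on [V] becomes left multiplication on the dual. *)
Lemma fsumsH_dual : fsumsH V = fsumsK tro_dual.
Proof.
apply/seteqP; split => _ [s _ <-].
  exists [seq (tro_adj p.1, tro_adj p.2) | p <- s] => //.
  by rewrite big_map; apply: eq_bigr => p _; rewrite /= adjK.
exists [seq (tro_unadj p.1, tro_unadj p.2) | p <- s] => //.
by rewrite big_map; apply: eq_bigr => p _; rewrite /= adjK.
Qed.

Lemma fsumsK_gen x y : fsumsK V (x \bo adj y).
Proof. by exists [:: (x, y)] => //; rewrite big_seq1. Qed.

Lemma fsumsK0 : fsumsK V 0.
Proof. by exists [::] => //; rewrite big_nil. Qed.

Lemma fsumsK_lin l a b : fsumsK V a -> fsumsK V b -> fsumsK V (l *: a + b).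
Proof.
move=> [s _ <-] [s' _ <-]; exists ([seq (l *: p.1, p.2) | p <- s] ++ s') => //.
rewrite big_cat big_map scaler_sumr; congr (_ + _).
by apply: eq_bigr => p _; rewrite tro_valZ bcompZl.
Qed.

Lemma fsumsK_adj a : fsumsK V a -> fsumsK V (adj a).
Proof.
move=> [s _ <-]; exists [seq (p.2, p.1) | p <- s] => //.
by rewrite big_map adj_sum; apply: eq_bigr => p _; rewrite adj_comp adjK.
Qed.

Lemma fsumsK_act a x : fsumsK V a -> a \bo x \in tro_set V.
Proof.
move=> [s _ <-]; rewrite bcomp_suml; elim: s => [|p s IH].
  by rewrite big_nil (tro_mem (0 : tro_sort V)).
by rewrite big_cons -[_ \bo _]scale1r (tro_lin _ (TroElt (tro_triple _ _ _)) (TroElt IH))// tro_mem.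
Qed.

Lemma fsumsK_comp a b : fsumsK V a -> fsumsK V b -> fsumsK V (a \bo b).
Proof.
move=> ha [s _ <-]; exists [seq (TroElt (fsumsK_act p.1 ha), p.2) | p <- s] => //.
by rewrite big_map bcomp_sumr; apply: eq_bigr => p _; rewrite /= bcompA.
Qed.

(* With b := a^* a = sum_j f_j g_j^*, the operator b^(2^n) is a sum of products
   of total size O(D^(2^n)), where D bounds the action of b on V; since
   |b^(2^n)| = |b|^(2^n), this forces |b| <= D. *)
Lemma fsumsK_lower a (c : R) : fsumsK V a -> 0 <= c ->
  (forall x, rnorm (a \bo x) <= c * rnorm x) -> rnorm a <= c.
Proof.
move=> Sa c0 ac; apply/ler_addgt0Pr => e e0.
have [->|a0] := eqVneq a 0; first by rewrite rnorm0 addr_ge0// ltW.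
have an := rnorm_gt0 a0.
(* $a^*a$ acts on [V] with norm at most |a| c; the slack [e] keeps [D] positive even for [c = 0], as
   the growth argument divides by [D]. *)
pose D := rnorm a * (c + e).
have D0 : 0 < D by rewrite mulr_gt0// ltr_wpDl.
pose pw := fun n => iter n (fun b : bop K K => b \bo b) (adj a \bo a).
have pwS n : pw n.+1 = pw n \bo pw n by [].
have pw_adj n : adj (pw n) = pw n.
  by elim: n => [|n IH]; rewrite ?pwS adj_comp ?adjK ?IH.
have pw_norm n : rnorm (pw n) = (rnorm a ^+ 2) ^+ (2 ^ n).
  elim: n => [|n IH]; first by rewrite /pw/= rnorm_adj_comp.
  by rewrite pwS -{1}pw_adj rnorm_adj_comp IH -exprM mulnC -expnS.
have pw_act n : fsumsK V (pw n) /\ forall x, rnorm (pw n \bo x) <= D ^+ (2 ^ n) * rnorm x.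
  elim: n => [|n [Sn IH]].
    split; first exact: fsumsK_comp (fsumsK_adj Sa) Sa.
    move=> x; rewrite /pw/= expr1 -bcompA (le_trans (rnorm_bcomp _ _))// rnorm_adj /D -mulrA.
    rewrite ler_wpM2l ?rnorm_ge0// (le_trans (ac x))// ler_wpM2r ?rnorm_ge0//.
    by rewrite lerDl ltW.
  split; first by rewrite pwS; apply: fsumsK_comp.
  move=> x; rewrite pwS -bcompA.
  have := IH (TroElt (fsumsK_act x Sn)) => /= h; rewrite (le_trans h)//.
  by rewrite expnS mulnC exprM expr2 -mulrA ler_wpM2l ?exprn_ge0 ?(ltW D0)// rnorm_tro IH.
pose size (s : seq (tro_sort V * tro_sort V)) := \sum_(p <- s) rnorm p.1 * rnorm p.2.
have [s0 _ s0E] := (pw_act 0%N).1.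
(* Letting [pw n] act on the first factors of a representation of [pw n] represents [pw n.+1] with
   the same number of summands, at the cost of a factor D^(2^n). The sizes grow like D^(2^n - 1);
   the extra [D] on the left avoids the subtraction. *)
have rep n : exists2 s : seq (tro_sort V * tro_sort V),
    \sum_(p <- s) (tro_val p.1 \bo adj p.2) = pw n & D * size s <= D ^+ (2 ^ n) * size s0.
  elim: n => [|n [s sE sD]]; first by exists s0.
  have [Sn An] := pw_act n.
  exists [seq (TroElt (fsumsK_act p.1 Sn), p.2) | p <- s].
    by rewrite big_map pwS -[X in _ = _ \bo X]sE bcomp_sumr; apply: eq_bigr => p _; rewrite /= bcompA.
  apply: (@le_trans _ _ (D * (D ^+ (2 ^ n) * size s))).
    rewrite ler_pM2l// /size big_map mulr_sumr ler_sum// => p _ /=.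
    by rewrite mulrA ler_wpM2r ?rnorm_ge0 ?An.
  by rewrite mulrCA expnS mulnC exprM expr2 -mulrA ler_wpM2l// exprn_ge0// (ltW D0).
have bound n : D * (rnorm a ^+ 2) ^+ (2 ^ n) <= D ^+ (2 ^ n) * size s0.
  have [s sE sD] := rep n; rewrite -pw_norm (le_trans _ sD)// ler_pM2l// -sE.
  rewrite (le_trans (rnorm_sum _ _))// ler_sum// => p _.
  by rewrite (le_trans (rnorm_bcomp _ _))// rnorm_adj.
have : rnorm a ^+ 2 <= D.
  rewrite leNgt; apply/negP => Dlt.
  pose h := rnorm a ^+ 2 / D - 1.
  have h0 : 0 < h by rewrite subr_gt0 ltr_pdivlMr// mul1r.
  (* A Bernoulli bound: if the ratio |a|^2 / D is 1 + h with h > 0, its powers with exponent 2^n are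
     unbounded, whereas [bound] keeps them below size s0 / D. *)
  have grow n : 1 + h + n%:R * h <= (rnorm a ^+ 2 / D) ^+ (2 ^ n).
    elim: n => [|n IH]; first by rewrite mul0r addr0 expr1 /h addrC subrK.
    rewrite expnS mulnC exprM.
    have nh : 0 <= n%:R * h by rewrite mulr_ge0// ltW.
    rewrite (@le_trans _ _ ((1 + h + n%:R * h) ^+ 2))//; last first.
      by rewrite lerXn2r ?nnegrE ?exprn_ge0 ?divr_ge0 ?sqr_ge0 ?(ltW D0)//; lra.
    by rewrite -natr1; nra.
  have bnd n : n%:R * h <= size s0 / D.
    apply: (@le_trans _ _ (1 + h + n%:R * h)); first by rewrite lerDr; lra.
    rewrite (le_trans (grow n))// expr_div_n ler_pdivlMr// mulrAC ler_pdivrMr ?exprn_gt0//.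
    by rewrite mulrC [leRHS]mulrC.
  have := bnd (Num.bound (size s0 / D / h)).
  rewrite -ler_pdivlMr// leNgt => /negP; apply.
  apply: archi_boundP; rewrite !divr_ge0 ?(ltW h0) ?(ltW D0)// sumr_ge0// => p _.
  by rewrite mulr_ge0 ?rnorm_ge0.
by rewrite /D expr2 ler_pM2l.
Qed.

End tro_theory.

(** * The max norm, and pairs of maps represented by one operator *)

Section product_norm.
Variables (R : realType) (V W : normedModType R[i]).
Implicit Types p : (V * W)%type.

Lemma rnorm_prodE p : rnorm p = Num.max (rnorm p.1) (rnorm p.2).
Proof.
apply: (fmorph_inj (real_complex R)); rewrite /= rnormE prod_normE -!rnormE.
by rewrite {1}/Num.max ltcR; case: ltP.
Qed.

Lemma rnorm_prod_fst p : rnorm p.1 <= rnorm p.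
Proof. by rewrite rnorm_prodE le_max lexx. Qed.

Lemma rnorm_prod_snd p : rnorm p.2 <= rnorm p.
Proof. by rewrite rnorm_prodE le_max lexx orbT. Qed.

Lemma rnorm_prod_le p (c : R) : rnorm p.1 <= c -> rnorm p.2 <= c -> rnorm p <= c.
Proof. by move=> h1 h2; rewrite rnorm_prodE ge_max h1. Qed.

End product_norm.

(* [S] acts on [V] by [act]; the two instances are [fsumsK V] acting by
   [f |-> - a f] and [fsumsH V] acting by [f |-> - f b], and their closures. *)
Record triple_rep (R : realType) (H K E : hilbertType R) (V : tro H K)
    (S : set (bop E E)) (act : bop E E -> bop H K -> bop H K) : Prop := {
  trep0 : S 0 ;
  trep_lin : forall l a b, S a -> S b -> S (l *: a + b) ;
  trep_adj : forall a, S a -> S (adj a) ;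
  trep_actl : forall l a b f, act (l *: a + b) f = l *: act a f + act b f ;
  trep_actr : forall l a f g, act a (l *: f + g) = l *: act a f + act a g ;
  trep_norm : forall a f, rnorm (act a f) <= rnorm a * rnorm f ;
  trep_mem : forall a (f : tro_sort V), S a -> act a f \in tro_set V ;
  trep_lower : forall a (c : R), S a -> 0 <= c ->
    (forall f : tro_sort V, rnorm (act a f) <= c * rnorm f) -> rnorm a <= c }.

Section triple_rep_theory.
Variables (R : realType) (H K E : hilbertType R) (V : tro H K).
Variables (act : bop E E -> bop H K -> bop H K).
Notation M := (tro_sort V).

(** The second component involves [adj a] because $\ell(x,y)$ pairs the action of $xy^*$ with that
    of $yx^*$, its adjoint. For [a] in [S], [trep_lower] makes the representing operator unique. *)
Definition isrep (A : opair M) (a : bop E E) : Prop :=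
  forall f : M, tro_val (A.1 f) = act a f /\ tro_val (A.2 f) = act (adj a) f.

Section fixed.
Variables (S : set (bop E E)) (HS : triple_rep V S act).

Lemma trep_actB a b f : act (a - b) f = act a f - act b f.
Proof. by rewrite addrC -scaleN1r (trep_actl HS) scaleN1r addrC. Qed.

Lemma trep_act0 f : act 0 f = 0.
Proof. by rewrite -(subrr 0) trep_actB subrr. Qed.

Lemma trep_sub a b : S a -> S b -> S (a - b).
Proof. by move=> Sa Sb; rewrite addrC -scaleN1r; apply: (trep_lin HS). Qed.

(** Each clause survives because [act] is continuous in the operator. In the lower bound an
    approximant within [e] costs [e] twice: once in its action on [V] and once in its norm. *)
Lemma trep_ncl : triple_rep V (ncl S) act.
Proof.
have actc a b f : rnorm (act a f - act b f) <= rnorm f * rnorm (a - b).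
  by rewrite -trep_actB mulrC (trep_norm HS).
split.
- exact/sub_ncl/(trep0 HS).
- move=> l a b Sa Sb.
  apply: (@ncl_map _ _ _ S S (fun b => l *: a + b) 1 _ _ b Sb) => [x y|b' Sb'].
    by rewrite opprD addrACA subrr add0r mul1r.
  apply: (@ncl_map _ _ _ S S (fun a => l *: a + b') (complex.Re `|l|) _ _ a Sa) => [x y|a' Sa'].
    by rewrite opprD addrACA subrr addr0 -scalerBr rnormZ.
  exact/sub_ncl/(trep_lin HS).
- move=> a Sa; apply: (@ncl_map _ _ _ S S (@adj R E E) 1 _ _ a Sa) => [x y|b Sb].
    by rewrite -adjB rnorm_adj mul1r.
  exact/sub_ncl/(trep_adj HS).
- exact: trep_actl HS.
- exact: trep_actr HS.
- exact: trep_norm HS.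
- move=> a f Sa; apply: tro_ncl.
  apply: (@ncl_map _ _ _ S _ (fun a => act a f) (rnorm f) _ _ a Sa) => [x y|b Sb].
    exact: actc.
  exact/sub_ncl/(trep_mem HS).
- move=> a c Sa c0 ac; apply: (@ler_addsmall _ _ _ 2) => // e e0.
  have [b Sb be] := Sa _ e0.
  have : rnorm b <= c + e.
    apply: (trep_lower HS Sb) => [|f]; first by rewrite addr_ge0// ltW.
    have -> : act b f = act a f + (act b f - act a f) by rewrite addrC subrK.
    rewrite (le_trans (ler_rnormD _ _))// mulrDl lerD//.
    rewrite -trep_actB (le_trans (trep_norm HS _ _))// ler_wpM2r ?rnorm_ge0// ltW//.
  have := rnorm_sub_triangle a b; rewrite rnormB; lra.
Qed.

Lemma isrep_inj A a b : S a -> S b -> isrep A a -> isrep A b -> a = b.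
Proof.
move=> Sa Sb Aa Ab; apply/eqP; rewrite -subr_eq0; apply/eqP/rnorm_eq0/eqP.
rewrite eq_le rnorm_ge0 andbT; apply: (trep_lower HS (trep_sub Sa Sb)) => // f.
by rewrite trep_actB -(Aa f).1 -(Ab f).1 subrr rnorm0 mul0r.
Qed.

Lemma isrep_exists a : S a -> exists A, isrep A a.
Proof.
move=> Sa; exists (fun f => TroElt (trep_mem HS f Sa),
                   fun f => TroElt (trep_mem HS f (trep_adj HS Sa))).
by [].
Qed.

Lemma isrep_uniq A A' a : isrep A a -> isrep A' a -> A = A'.
Proof.
case: A A' => [A1 A2] [A1' A2'] Aa Aa'; congr pair; apply/funext => f; apply: tro_val_inj.
  by rewrite (Aa f).1 (Aa' f).1.
by rewrite (Aa f).2 (Aa' f).2.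
Qed.

Lemma isrep0 : isrep 0 0.
Proof. by move=> f; rewrite adj0 trep_act0. Qed.

Lemma isrep_lin l A B a b : isrep A a -> isrep B b -> isrep (l *: A + B) (l *: a + b).
Proof.
move=> Aa Bb f; rewrite adjD adjZ !(trep_actl HS) -(Aa f).1 -(Aa f).2 -(Bb f).1 -(Bb f).2.
by split.
Qed.

Lemma isrep_bar A a : isrep A a -> isrep (opair_bar A) (adj a).
Proof. by move=> Aa f; rewrite adjK -(Aa f).1 -(Aa f).2. Qed.

Lemma isrep_diag A a : isrep A a ->
  exists2 T : bop (M * M)%type (M * M)%type, T = diag A :> (_ -> _) & rnorm T <= rnorm a.
Proof.
move=> Aa.
have bnd p : rnorm (diag A p) <= rnorm a * rnorm p.
  apply: rnorm_prod_le; rewrite /= rnorm_tro ?(Aa _).1 ?(Aa _).2 (le_trans (trep_norm HS _ _))//.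
    by rewrite ler_wpM2l ?rnorm_ge0//; exact: (rnorm_prod_fst p).
  by rewrite rnorm_adj ler_wpM2l ?rnorm_ge0//; exact: (rnorm_prod_snd p).
have lin : linear (diag A).
  move=> l p q; congr pair; apply: tro_val_inj.
    transitivity (l *: tro_val (A.1 p.1) + tro_val (A.1 q.1)) => //.
    by rewrite !(Aa _).1 -(trep_actr HS).
  transitivity (l *: tro_val (A.2 p.2) + tro_val (A.2 q.2)) => //.
  by rewrite !(Aa _).2 -(trep_actr HS).
have [T TA] := @bop_exists _ _ _ _ (rnorm a) lin bnd.
exists T; first exact/funext.
by apply: rnorm_bop_le => [|p]; rewrite ?rnorm_ge0// TA.
Qed.

(** Under the max norm the upper bound follows from |adj a| = |a|. The lower bound comes from the
    vectors (f, 0), on which [trep_lower] applies. *)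
Lemma opair_norm_isrep A a : S a -> isrep A a -> opair_norm A = rnorm a.
Proof.
move=> Sa Aa; have [T TA Ta] := isrep_diag Aa; rewrite /opair_norm -TA.
apply/eqP; rewrite eq_le; apply/andP; split=> //.
apply: (trep_lower HS) => //; first exact: (@rnorm_ge0 _ _ T).
move=> f; rewrite -(Aa f).1 -rnorm_tro.
have /= h := rnorm_bop T (f, 0); rewrite TA in h.
rewrite (le_trans (rnorm_prod_fst (diag A (f, 0))))// (le_trans h)//.
rewrite -rnorm_bopE ler_wpM2l ?rnorm_ge0//.
by apply: rnorm_prod_le => //=; rewrite rnorm0 rnorm_ge0.
Qed.

(** Forward: the operators approximating [T] come from elements of [S] whose mutual distances are
    controlled by [trep_lower]; they converge to some [a], which represents [A] by pointwise
    comparison. Backward: a difference of represented pairs is represented by the difference, so its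
    operator norm is at most that of [b - a]. *)
Lemma opair_closure_isrep (L : set (opair M)) :
  (forall A, L A <-> exists2 a, S a & isrep A a) ->
  forall A, opair_closure L A <-> exists2 a, ncl S a & isrep A a.
Proof.
move=> HL A; split.
  move=> [T]; rewrite closure_ncl => clT TA.
  have pt (T' : bop (M * M)%type (M * M)%type) A' f g : T' = diag A' :> (_ -> _) ->
      rnorm (A'.1 f - A.1 f) <= rnorm (T' - T) * rnorm f /\
      rnorm (A'.2 g - A.2 g) <= rnorm (T' - T) * rnorm g.
    move=> TA'; split.
      have := rnorm_bop (T' - T) (f, 0); rewrite bopBE TA TA' => h.
      rewrite (le_trans (rnorm_prod_fst (diag A' (f, 0) - diag A (f, 0))))// (le_trans h)//.
      rewrite ler_wpM2l ?rnorm_ge0//.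
      by apply: rnorm_prod_le => //=; rewrite rnorm0 rnorm_ge0.
    have := rnorm_bop (T' - T) (0, g); rewrite bopBE TA TA' => h.
    rewrite (le_trans (rnorm_prod_snd (diag A' (0, g) - diag A (0, g))))// (le_trans h)//.
    rewrite ler_wpM2l ?rnorm_ge0//.
    by apply: rnorm_prod_le => //=; rewrite rnorm0 rnorm_ge0.
  pose P (e : R) a := S a /\ exists A' T', [/\ isrep A' a,
    (T' : bop (M * M)%type (M * M)%type) = diag A' :> (_ -> _) & rnorm (T' - T) <= e].
  have [e e0|e e' a a' e0 e'0|a Pa] := @rcomplete_bop _ E E (@rcomplete_complete _ E) P.
  - have [T' [A' LA' TA'] T'e] := clT _ e0.
    have [a Sa A'a] := iffLR (HL _) LA'; exists a; split=> //.
    by exists A', T'; split=> //; exact: ltW.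
  - move=> [Sa [A1 [T1 [A1a T1A1 T1e]]]] [Sa' [A2 [T2 [A2a T2A2 T2e]]]].
    apply: (trep_lower HS (trep_sub Sa Sa')) => [|f]; first by rewrite addr_ge0// ltW.
    rewrite trep_actB -(A1a f).1 -(A2a f).1 -tro_valB -rnorm_tro.
    rewrite (le_trans (ler_rnorm_dist _ (A.1 f) _))// [X in _ + X]rnormB mulrDl.
    apply: lerD.
      by apply: (le_trans (pt _ _ f 0 T1A1).1); rewrite ler_wpM2r ?rnorm_ge0.
    by apply: (le_trans (pt _ _ f 0 T2A2).1); rewrite ler_wpM2r ?rnorm_ge0.
exists a.
    move=> e e0; have e2 : 0 < e / 2 by rewrite divr_gt0.
    have [T' [A' LA' TA'] T'e] := clT _ e2.
    have [b Sb A'b] := iffLR (HL _) LA'; exists b => //.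
    rewrite (le_lt_trans (Pa (e / 2) _ _ _))//; last by lra.
    by split=> //; exists A', T'; split=> //; exact: ltW.
  move=> f; split; apply/eqP; rewrite -subr_eq0; apply/eqP/rnorm_eq0/eqP;
    rewrite eq_le rnorm_ge0 andbT; apply: (@ler_addsmall _ _ _ (2 * rnorm f));
    rewrite ?mulr_ge0 ?rnorm_ge0// => e e0; rewrite add0r mulrCA [leRHS]mulrDl mul1r.
    have [T' [A' LA' TA'] T'e] := clT _ e0.
    have [b Sb A'b] := iffLR (HL _) LA'.
    have ba : rnorm (b - a) <= e.
      by apply: Pa => //; split=> //; exists A', T'; split=> //; exact: ltW.
    rewrite (le_trans (ler_rnorm_dist _ (tro_val (A'.1 f)) _))// lerD//.
      rewrite rnormB -tro_valB -rnorm_tro (le_trans (pt _ _ f 0 TA').1)//.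
      by rewrite ler_wpM2r ?rnorm_ge0// ltW.
    by rewrite (A'b f).1 -trep_actB (le_trans (trep_norm HS _ _))// ler_wpM2r ?rnorm_ge0.
  have [T' [A' LA' TA'] T'e] := clT _ e0.
  have [b Sb A'b] := iffLR (HL _) LA'.
  have ba : rnorm (b - a) <= e.
    by apply: Pa => //; split=> //; exists A', T'; split=> //; exact: ltW.
  rewrite (le_trans (ler_rnorm_dist _ (tro_val (A'.2 f)) _))// lerD//.
    rewrite rnormB -tro_valB -rnorm_tro (le_trans (pt _ _ 0 f TA').2)//.
    by rewrite ler_wpM2r ?rnorm_ge0// ltW.
  rewrite (A'b f).2 -trep_actB (le_trans (trep_norm HS _ _))// -adjB rnorm_adj.
  by rewrite ler_wpM2r ?rnorm_ge0.
move=> [a Sa Aa]; have [T TA _] := isrep_diag Aa; exists T => //.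
rewrite closure_ncl => e e0; have [b Sb be] := Sa _ e0.
have [A' A'b] := isrep_exists Sb.
have [T' TA' _] := isrep_diag A'b; exists T'; first by exists A' => //; apply/HL; exists b.
have [T2 T2A T2ba] := isrep_diag (isrep_lin (-1) Aa A'b).
rewrite (_ : T' - T = T2); last first.
  apply: bop_ext => p; rewrite bopBE TA TA' T2A.
  transitivity (A'.1 p.1 - A.1 p.1, A'.2 p.2 - A.2 p.2); first by [].
  transitivity (-1 *: A.1 p.1 + A'.1 p.1, (-1)^* *: A.2 p.2 + A'.2 p.2); last by [].
  by rewrite rmorphN1 !scaleN1r; congr pair; rewrite addrC.
by rewrite (le_lt_trans T2ba)// scaleN1r addrC.
Qed.

(** [lspan] carries scalar coefficients, while the elements of [S] are plain sums of generators. The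
    clauses of [triple_rep] absorb the scalars in one direction; coefficients 1 suffice in the
    other. *)
Lemma lspan_isrep (g : M -> M -> opair M) (c : M -> M -> bop E E) :
  (forall x y, isrep (g x y) (c x y)) -> (forall x y, S (c x y)) ->
  (forall a, S a -> exists s : seq (M * M), \sum_(p <- s) c p.1 p.2 = a) ->
  forall A, lspan [set g x y | x in setT & y in setT] A <-> exists2 a, S a & isrep A a.
Proof.
move=> gc Sc Ssum A; split.
  move=> [s + <-]; elim: s => [|p s IH] sS.
    by rewrite big_nil; exists 0; [exact: trep0 HS|exact: isrep0].
  have [q qs|a Sa aE] := IH; first by apply: sS; rewrite inE qs orbT.
  have /sS[x _ [y _ xyE]] := mem_head p s.
  rewrite big_cons -xyE; exists (p.1 *: c x y + a); first exact: (trep_lin HS).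
  exact: isrep_lin.
move=> [a Sa Aa]; have [s sa] := Ssum _ Sa.
have -> : A = \sum_(p <- s) g p.1 p.2.
  apply: (isrep_uniq Aa); rewrite -{}sa; elim: s => [|p s IH].
    by rewrite !big_nil; exact: isrep0.
  by rewrite !big_cons -[g _ _]scale1r -[c _ _]scale1r; exact: isrep_lin.
exists [seq (1, g p.1 p.2) | p <- s]; last first.
  by rewrite big_map; apply: eq_bigr => p _; rewrite scale1r.
by move=> q /mapP[p _ ->] /=; exists p.1 => //; exists p.2.
Qed.

End fixed.
End triple_rep_theory.

(** * Transport of star-algebra structure along a relation *)

Section star_isomorphism_of_relation.
Variables (R : realType) (U W : lmodType R[i]).
Variables (rel : U -> W -> Prop) (phi : U -> W).
Variables (mulU : U -> U -> U) (starU : U -> U) (mulW : W -> W -> W) (starW : W -> W).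

(** Both sides of each law in [U] are related to the same element of [W], where the law holds
    without restriction; injectivity of the relation then equates them. So the laws of [U] need no
    separate verification. *)
Lemma rel_star_isomorphism :
  rel 0 0 ->
  (forall l a a' T T', rel a T -> rel a' T' -> rel (l *: a + a') (l *: T + T')) ->
  (forall a a' T T', rel a T -> rel a' T' -> rel (mulU a a') (mulW T T')) ->
  (forall a T, rel a T -> rel (starU a) (starW T)) ->
  (forall a a' T, rel a T -> rel a' T -> a = a') ->
  (forall a T, rel a T -> phi a = T) ->
  (forall l T1 T2 T3, mulW (l *: T1 + T2) T3 = l *: mulW T1 T3 + mulW T2 T3) ->
  (forall l T1 T2 T3, mulW T3 (l *: T1 + T2) = l *: mulW T3 T1 + mulW T3 T2) ->
  (forall T1 T2 T3, mulW T1 (mulW T2 T3) = mulW (mulW T1 T2) T3) ->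
  (forall l T1 T2, starW (l *: T1 + T2) = l^* *: starW T1 + starW T2) ->
  (forall T1 T2, starW (mulW T1 T2) = mulW (starW T2) (starW T1)) ->
  involutive starW ->
  star_isomorphism [set a | exists T, rel a T] mulU starU
    [set T | exists a, rel a T] mulW starW phi.
Proof.
move=> r0 rlin rmul rstar rinj rphi ml mr mA slin sM sK; split.
- split.
  + by exists 0.
  + by move=> l a b [T aT] [T' bT']; exists (l *: T + T'); exact: rlin.
  + by move=> a b [T aT] [T' bT']; exists (mulW T T'); exact: rmul.
  + by move=> a [T aT]; exists (starW T); exact: rstar.
  + move=> l a b c [Ta aT] [Tb bT] [Tc cT].
    apply: (rinj _ _ (mulW (l *: Ta + Tb) Tc)); first by apply: rmul => //; exact: rlin.
    by rewrite ml; apply: rlin; exact: rmul.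
  + move=> l a b c [Ta aT] [Tb bT] [Tc cT].
    apply: (rinj _ _ (mulW Tc (l *: Ta + Tb))); first by apply: rmul => //; exact: rlin.
    by rewrite mr; apply: rlin; exact: rmul.
  + move=> a b c [Ta aT] [Tb bT] [Tc cT].
    apply: (rinj _ _ (mulW Ta (mulW Tb Tc))); first exact: rmul aT (rmul _ _ _ _ bT cT).
    by rewrite mA; exact: rmul (rmul _ _ _ _ aT bT) cT.
  + move=> l a b [Ta aT] [Tb bT].
    apply: (rinj _ _ (starW (l *: Ta + Tb))); first by apply: rstar; exact: rlin.
    by rewrite slin; apply: rlin; exact: rstar.
  + move=> a b [Ta aT] [Tb bT].
    apply: (rinj _ _ (starW (mulW Ta Tb))); first by apply: rstar; exact: rmul.
    by rewrite sM; apply: rmul; exact: rstar.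
  + by move=> a [T aT]; apply: (rinj _ _ (starW (starW T))); [exact/rstar/rstar|rewrite sK].
- split=> //.
  + by exists 0.
  + by move=> l T T' [a aT] [b bT']; exists (l *: a + b); exact: rlin.
  + by move=> T T' [a aT] [b bT']; exists (mulU a b); exact: rmul.
  + by move=> T [a aT]; exists (starU a); exact: rstar.
- split.
  + by move=> a [T aT]; exists a; rewrite (rphi _ _ aT).
  + move=> a b /set_mem[T aT] /set_mem[T' bT']; rewrite (rphi _ _ aT) (rphi _ _ bT') => TT'.
    by apply: (rinj _ _ T) => //; rewrite TT'.
  + by move=> T [a aT]; exists a; [exists T|exact: rphi].
- move=> l a b [T aT] [T' bT'].
  by rewrite (rphi _ _ aT) (rphi _ _ bT'); apply: rphi; exact: rlin.
- move=> a b [T aT] [T' bT'].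
  by rewrite (rphi _ _ aT) (rphi _ _ bT'); apply: rphi; exact: rmul.
- by move=> a [T aT]; rewrite (rphi _ _ aT); apply: rphi; exact: rstar.
Qed.

End star_isomorphism_of_relation.

(** * The standard embedding and its correspondence with block operators *)

Section embedding.
Variables (R : realType) (H K : hilbertType R) (V : tro H K).
Notation M := (tro_sort V).
Notation t := (@anti_triple R H K V).
Implicit Types (a b : embmx M) (T : bop (l2sum K H) (l2sum K H)).

Definition act_left (al : bop K K) (f : bop H K) : bop H K := - (al \bo f).
Definition act_right (be : bop H H) (f : bop H K) : bop H K := - (f \bo be).

Notation repL := (@isrep R H K K V act_left).
Notation repR := (@isrep R H K H V act_right).

Lemma triple_rep_left : triple_rep V (fsumsK V) act_left.
Proof.
split.
- exact: fsumsK0.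
- exact: fsumsK_lin.
- exact: fsumsK_adj.
- by move=> l al be f; rewrite /act_left bcompDl bcompZl opprD scalerN.
- by move=> l al f g; rewrite /act_left bcompDr bcompZr opprD scalerN.
- by move=> al f; rewrite rnormN rnorm_bcomp.
- by move=> al f Sa; rewrite rpredN fsumsK_act.
- move=> al c Sa c0 h; apply: (fsumsK_lower Sa) => // f.
  by have := h f; rewrite rnormN.
Qed.

Lemma fsumsH_act be (f : M) : fsumsH V be -> f \bo be \in tro_set V.
Proof.
rewrite fsumsH_dual => /fsumsK_adj Sb; have := fsumsK_act (tro_adj f) Sb.
by rewrite inE/= adj_comp !adjK.
Qed.

Lemma triple_rep_right : triple_rep V (fsumsH V) act_right.
Proof.
split; rewrite ?fsumsH_dual.
- exact: fsumsK0.
- exact: fsumsK_lin.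
- exact: fsumsK_adj.
- by move=> l al be f; rewrite /act_right bcompDr bcompZr opprD scalerN.
- by move=> l al f g; rewrite /act_right bcompDl bcompZl opprD scalerN.
- by move=> al f; rewrite rnormN mulrC rnorm_bcomp.
- by move=> al f Sa; rewrite rpredN fsumsH_act// fsumsH_dual.
(* The adjoint of [f \bo al] is a left action of [adj al] on the dual TRO, to which [fsumsK_lower]
   applies. *)
- move=> al c /fsumsK_adj Sa c0 h; rewrite -rnorm_adj; apply: (fsumsK_lower Sa) => // f.
  by have := h (tro_unadj f); rewrite rnormN -rnorm_adj adj_comp adjK !rnorm_tro /= rnorm_adj.
Qed.

Lemma ell_isrep (x y : M) : repL (ell t x y) (x \bo adj y).
Proof. by move=> f; rewrite /act_left adj_comp adjK. Qed.

Lemma arr_isrep (x y : M) : repR (arr t x y) (adj x \bo y).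
Proof. by move=> f; rewrite /act_right adj_comp adjK !bcompA. Qed.

Lemma fsumsH_gen (x y : M) : fsumsH V (adj x \bo y).
Proof. by exists [:: (x, y)] => //; rewrite big_seq1. Qed.

Lemma L0_isrep A : L0 t A <-> exists2 al, fsumsK V al & repL A al.
Proof.
apply: (lspan_isrep triple_rep_left ell_isrep) => [x y|al [s _ sE]]; first exact: fsumsK_gen.
by exists s.
Qed.

Lemma R0_isrep A : R0 t A <-> exists2 be, fsumsH V be & repR A be.
Proof.
apply: (lspan_isrep triple_rep_right arr_isrep) => [x y|al [s _ sE]]; first exact: fsumsH_gen.
by exists s.
Qed.

Lemma Lcl_isrep A : Lcl t A <-> exists2 al, ncl (fsumsK V) al & repL A al.
Proof. exact: (opair_closure_isrep triple_rep_left L0_isrep). Qed.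

Lemma Rcl_isrep A : Rcl t A <-> exists2 be, ncl (fsumsH V) be & repR A be.
Proof. exact: (opair_closure_isrep triple_rep_right R0_isrep). Qed.

(** What the isomorphism proof needs from the two diagonal algebras. The finite sums and their
    closures both satisfy it, so the proof is carried out once. *)
Record corner_algebras (SK : set (bop K K)) (SH : set (bop H H)) : Prop := {
  corner_left : triple_rep V SK act_left ;
  corner_right : triple_rep V SH act_right ;
  corner_leftM : forall x y, SK x -> SK y -> SK (x \bo y) ;
  corner_rightM : forall x y, SH x -> SH y -> SH (x \bo y) ;
  corner_left_gen : forall x y : M, SK (x \bo adj y) ;
  corner_right_gen : forall x y : M, SH (adj x \bo y) }.

Lemma fsums_corner_algebras : corner_algebras (fsumsK V) (fsumsH V).
Proof.
split.
- exact: triple_rep_left.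
- exact: triple_rep_right.
- exact: fsumsK_comp.
- by rewrite fsumsH_dual; exact: fsumsK_comp.
- exact: fsumsK_gen.
- exact: fsumsH_gen.
Qed.

Lemma ncl_comp (E : hilbertType R) (S : set (bop E E)) :
  (forall x y, S x -> S y -> S (x \bo y)) ->
  forall x y, ncl S x -> ncl S y -> ncl S (x \bo y).
Proof.
move=> SM x y Sx Sy.
apply: (@ncl_map _ _ _ S S (fun y => x \bo y) (rnorm x) _ _ y Sy) => [u v|v Sv].
  by rewrite -bcompBr rnorm_bcomp.
apply: (@ncl_map _ _ _ S S (fun x => x \bo v) (rnorm v) _ _ x Sx) => [u w|u Su].
  by rewrite -bcompBl mulrC rnorm_bcomp.
exact/sub_ncl/SM.
Qed.

Lemma ncl_corner_algebras : corner_algebras (ncl (fsumsK V)) (ncl (fsumsH V)).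
Proof.
have [cl cr clM crM clg crg] := fsums_corner_algebras; split.
- exact: trep_ncl.
- exact: trep_ncl.
- exact: ncl_comp.
- exact: ncl_comp.
- by move=> x y; apply: sub_ncl.
- by move=> x y; apply: sub_ncl.
Qed.

(** The graph of the isomorphism, with the diagonal operators ranging over [SK] and [SH]. *)
Definition emb_rel SK SH a T := exists al be,
  [/\ SK al, SH be, repL a.1.1 al, repR a.2.2 be &
      T = block al (tro_val a.1.2) (adj (tro_val (a.2.1 : M))) be].

Section corner.
Variables (SK : set (bop K K)) (SH : set (bop H H)) (HS : corner_algebras SK SH).
Notation rel := (emb_rel SK SH).

Let HL := corner_left HS.
Let HR := corner_right HS.

Lemma emb_rel0 : rel 0 0.
Proof.
exists 0, 0; split; [exact: trep0 HL|exact: trep0 HR|exact: isrep0 HL|exact: isrep0 HR|].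
by rewrite !tro_val0 adj0 block0.
Qed.

Lemma emb_rel_lin l a a' T T' : rel a T -> rel a' T' -> rel (l *: a + a') (l *: T + T').
Proof.
move=> [al [be [Sa Sb La Rb ->]]] [al' [be' [Sa' Sb' La' Rb' ->]]].
exists (l *: al + al'), (l *: be + be'); split.
- exact: (trep_lin HL).
- exact: (trep_lin HR).
- exact: (isrep_lin HL).
- exact: (isrep_lin HR).
- by rewrite block_lin /= adjD adjZ conjCK.
Qed.

Lemma emb_rel_mul a a' T T' : rel a T -> rel a' T' -> rel (emb_mul t a a') (block_mul T T').
Proof.
case: a a' => [[A f] [g B]] [[A' f'] [g' B']].
move=> [al [be [/= Sa Sb La Rb ->]]] [al' [be' [/= Sa' Sb' La' Rb' ->]]].
rewrite block_mulE; exists (- (al \bo al') + f \bo adj (tro_val g')).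
exists (adj (tro_val g) \bo f' - be \bo be'); split => /=.
- rewrite -scaleN1r; apply: (trep_lin HL); first exact: (corner_leftM HS).
  exact: (corner_left_gen HS).
- rewrite addrC -scaleN1r; apply: (trep_lin HR); first exact: (corner_rightM HS).
  exact: (corner_right_gen HS).
(* Acting by [- al'] and then by [- al] is multiplication by [al \bo al'], which is the action of
   its negative: the source of the minus signs on the diagonal of [block_mul]. *)
- rewrite -[lmul _ _]scale1r -[- (al \bo al')]scale1r; apply: (isrep_lin HL); last exact: ell_isrep.
  move=> h; rewrite /= (La _).1 (La' _).1 (La' _).2 (La _).2 /act_left.
  by rewrite adjN adj_comp !(bcompNl, bcompNr) !opprK !bcompA.
- rewrite -[arr _ _ _]scale1r -[adj _ \bo _]scale1r; apply: (isrep_lin HR); first exact: arr_isrep.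
  move=> h; rewrite /= (Rb' _).1 (Rb _).1 (Rb _).2 (Rb' _).2 /act_right.
  by rewrite adjN adj_comp !(bcompNl, bcompNr) !opprK !bcompA.
- have -> : - (al \bo f') - f \bo be' = tro_val (A.1 f' + B'.1 f).
    by rewrite tro_valD (La _).1 (Rb' _).1.
  have -> : - (adj (tro_val g) \bo al') - be \bo adj (tro_val g') =
      adj (tro_val (A'.2 g + B.2 g')).
    by rewrite tro_valD adjD (La' _).2 (Rb _).2 !adjN !adj_comp !adjK.
  by [].
Qed.

Lemma emb_rel_star a T : rel a T -> rel (emb_star a) (block_star T).
Proof.
case: a => [[A f] [g B]] [al [be [/= Sa Sb La Rb ->]]].
rewrite block_starE; exists (adj al), (adj be); split=> /=.
- exact: (trep_adj HL).
- exact: (trep_adj HR).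
- exact: isrep_bar.
- exact: isrep_bar.
- by rewrite adjK.
Qed.

Lemma emb_rel_inj a a' T : rel a T -> rel a' T -> a = a'.
Proof.
case: a a' => [[A f] [g B]] [[A' f'] [g' B']].
move=> [al [be [/= Sa Sb La Rb ->]]] [al' [be' [/= Sa' Sb' La' Rb' E]]].
have [e1 e2 e3 e4] := block_inj E; subst al' be'.
rewrite (isrep_uniq La La') (isrep_uniq Rb Rb') (tro_val_inj e2).
by rewrite (tro_val_inj (can_inj (@adjK _ _ _) e3)).
Qed.

(** This makes the linear extension in the diagonal entries well defined: equal pairs force equal
    operators, by [trep_lower]. *)
Lemma emb_rel_fun a T T' : rel a T -> rel a T' -> T = T'.
Proof.
move=> [al [be [Sa Sb La Rb ->]]] [al' [be' [Sa' Sb' La' Rb' ->]]].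
by rewrite (isrep_inj HL Sa Sa' La La') (isrep_inj HR Sb Sb' Rb Rb').
Qed.

Lemma emb_star_isomorphism phi : (forall a T, rel a T -> phi a = T) ->
  star_isomorphism [set a | exists T, rel a T] (emb_mul t) (@emb_star _ _)
    [set T | exists a, rel a T] (@block_mul _ _ _) (@block_star _ _ _) phi.
Proof.
move=> rphi; apply: rel_star_isomorphism => //.
- exact: emb_rel0.
- exact: emb_rel_lin.
- exact: emb_rel_mul.
- exact: emb_rel_star.
- exact: emb_rel_inj.
- exact: block_mul_linl.
- exact: block_mul_linr.
- exact: block_mulA.
- exact: block_star_lin.
- exact: block_starM.
- exact: block_starK.
Qed.

Lemma emb_rel_dom : [set a | exists T, rel a T] =
  [set a | (exists2 al, SK al & repL a.1.1 al) /\ (exists2 be, SH be & repR a.2.2 be)].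
Proof.
apply/seteqP; split=> a.
  by move=> [T [al [be [Sa Sb La Rb _]]]]; split; [exists al|exists be].
move=> [[al Sa La] [be Sb Rb]].
by exists (block al (tro_val a.1.2) (adj (tro_val (a.2.1 : M))) be), al, be.
Qed.

Lemma emb_rel_cod : [set T | exists a, rel a T] =
  [set T | exists al be (z w : M), [/\ SK al, SH be & T = block al z (adj w) be]].
Proof.
apply/seteqP; split=> T.
  by move=> [a [al [be [Sa Sb La Rb TE]]]]; exists al, be, a.1.2, a.2.1.
move=> [al [be [z [w [Sa Sb ->]]]]].
have [A La] := isrep_exists HL Sa; have [B Rb] := isrep_exists HR Sb.
by exists (Mx A z w B), al, be.
Qed.

End corner.

Notation rel0 := (emb_rel (fsumsK V) (fsumsH V)).
Notation relc := (emb_rel (ncl (fsumsK V)) (ncl (fsumsH V))).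

Lemma emb0_rel : emb0 t = [set a | exists T, rel0 a T].
Proof.
rewrite emb_rel_dom; apply/seteqP; split=> a.
  by move=> [/L0_isrep ? /R0_isrep].
by move=> [? ?]; split; [apply/L0_isrep|apply/R0_isrep].
Qed.

Lemma emb_relc : emb t = [set a | exists T, relc a T].
Proof.
rewrite emb_rel_dom; apply/seteqP; split=> a.
  by move=> [/Lcl_isrep ? /Rcl_isrep].
by move=> [? ?]; split; [apply/Lcl_isrep|apply/Rcl_isrep].
Qed.

Lemma B0_rel : B0 V = [set T | exists a, rel0 a T].
Proof. by rewrite (emb_rel_cod fsums_corner_algebras). Qed.

(** Reading off a block is a contraction, so each block of a limit lies in the closure of its
    corner, and the off-diagonal corners are closed because [V] is. Conversely only the two diagonal
    blocks have to be approximated. *)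
Lemma closure_B0_rel : closure (B0 V) = [set T | exists a, relc a T].
Proof.
rewrite (emb_rel_cod ncl_corner_algebras) closure_ncl; apply/seteqP; split=> T.
  move=> clT.
  have b11 : ncl (fsumsK V) (block11 T).
    apply: (@ncl_map _ _ _ (B0 V) _ (@block11 _ _ _) 1 _ _ T clT).
      move=> T1 T2; rewrite mul1r (_ : _ - _ = block11 (T1 - T2)) ?rnorm_block11//.
      by rewrite /block11 bcompBr bcompBl.
    by move=> _ [al [be [z [w [Sa Sb ->]]]]]; rewrite block11K; exact: sub_ncl.
  have b22 : ncl (fsumsH V) (block22 T).
    apply: (@ncl_map _ _ _ (B0 V) _ (@block22 _ _ _) 1 _ _ T clT).
      move=> T1 T2; rewrite mul1r (_ : _ - _ = block22 (T1 - T2)) ?rnorm_block22//.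
      by rewrite /block22 bcompBr bcompBl.
    by move=> _ [al [be [z [w [Sa Sb ->]]]]]; rewrite block22K; exact: sub_ncl.
  have b12 : block12 T \in tro_set V.
    apply: tro_ncl; apply: (@ncl_map _ _ _ (B0 V) _ (@block12 _ _ _) 1 _ _ T clT).
      move=> T1 T2; rewrite mul1r (_ : _ - _ = block12 (T1 - T2)) ?rnorm_block12//.
      by rewrite /block12 bcompBr bcompBl.
    move=> _ [al [be [z [w [Sa Sb ->]]]]]; rewrite block12K; apply: sub_ncl; exact: tro_mem.
  have b21 : adj (block21 T) \in tro_set V.
    apply: tro_ncl.
    apply: (@ncl_map _ _ _ (B0 V) _ (fun T => adj (block21 T)) 1 _ _ T clT).
      move=> T1 T2; rewrite mul1r -adjB rnorm_adj.
      rewrite (_ : _ - _ = block21 (T1 - T2)) ?rnorm_block21//.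
      by rewrite /block21 bcompBr bcompBl.
    move=> _ [al [be [z [w [Sa Sb ->]]]]]; rewrite block21K adjK; apply: sub_ncl; exact: tro_mem.
  exists (block11 T), (block22 T), (TroElt b12), (TroElt b21); split=> //.
  by rewrite /= adjK -block_eta.
move=> [al [be [z [w [Sa Sb ->]]]]] e e0; have e2 : 0 < e / 2 by rewrite divr_gt0.
have [al' Sa' ae] := Sa _ e2; have [be' Sb' be_] := Sb _ e2.
exists (block al' z (adj w) be'); first by exists al', be', z, w.
rewrite -scaleN1r addrC block_lin !scaleN1r !addNr.
rewrite (le_lt_trans (rnorm_block_le _ _ _ _))// !rnorm0 !addr0 [e]splitr.
by rewrite ltrD// addrC.
Qed.

Lemma emb_rel_ncl a T : rel0 a T -> relc a T.
Proof.
by move=> [al [be [Sa Sb La Rb ->]]]; exists al, be; split=> //; exact: sub_ncl.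
Qed.

End embedding.

(** * Comparison of the norm of the embedding with the operator norm of the blocks *)

Lemma homogeneous_bound (R : realType) (U W : normedModType R[i]) (S : set U) (g : U -> W) (c : R) :
  (forall (r : R) x, S x -> S (r%:C%C *: x)) ->
  (forall (r : R) x, g (r%:C%C *: x) = r%:C%C *: g x) ->
  (forall x, S x -> rnorm x <= 1 -> rnorm (g x) <= c) ->
  forall x, S x -> rnorm (g x) <= c * rnorm x.
Proof.
move=> SZ gZ gc x Sx; have [->|x0] := eqVneq x 0.
  have -> : g 0 = 0 by rewrite -{1}(scaler0 _ 0%:C%C) gZ; exact: scale0r.
  by rewrite !rnorm0 mulr0.
have xp := rnorm_gt0 x0; have xi : 0 <= (rnorm x)^-1 by rewrite invr_ge0 ltW.
rewrite -ler_pdivrMr// mulrC -[X in X * _]ger0_norm// -rnormZr -gZ.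
by apply: gc; [exact: SZ|rewrite rnormZr ger0_norm// mulVf// gt_eqF].
Qed.

Section embedding_norm.
Variables (R : realType) (H K : hilbertType R) (V : tro H K).
Notation M := (tro_sort V).
Notation t := (@anti_triple R H K V).
Notation SK := (ncl (fsumsK V)).
Notation SH := (ncl (fsumsH V)).
Notation rel := (@emb_rel R H K V SK SH).
Notation repL := (@isrep R H K K V (@act_left R H K)).
Notation repR := (@isrep R H K H V (@act_right R H K)).

Let HS := ncl_corner_algebras V.
Let HL := corner_left HS.
Let HR := corner_right HS.

Lemma emb_vec_norm_rep (f : M) B be : SH be -> repR B be ->
  emb_vec_norm (f, B) = l2norm (rnorm f) (rnorm be).
Proof. by move=> Sb Rb; rewrite /emb_vec_norm /= (opair_norm_isrep HR Sb Rb). Qed.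

Section fixed.
Variables (A : opair M) (f g : M) (B : opair M) (al : bop K K) (be : bop H H).
Hypotheses (Sa : SK al) (Sb : SH be) (La : repL A al) (Rb : repR B be).
Let a := Mx A f g B.
Let T := block al (tro_val f) (adj (tro_val g)) be.

Lemma emb_rep_norm f' B' be' : SH be' -> repR B' be' ->
  emb_vec_norm (emb_rep t a (f', B')) =
  l2norm (rnorm (al \bo tro_val f' + tro_val f \bo be'))
         (rnorm (adj (tro_val g) \bo tro_val f' - be \bo be')).
Proof.
move=> Sb' Rb'.
rewrite (@emb_vec_norm_rep _ _ (adj (tro_val g) \bo tro_val f' - be \bo be')).
- rewrite rnorm_tro tro_valD (La _).1 (Rb' _).1 /act_left /act_right.
  by rewrite -opprD rnormN.
- rewrite addrC -scaleN1r; apply: (trep_lin HR); first exact: (corner_rightM HS).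
  exact: (corner_right_gen HS).
- rewrite -[arr _ _ _]scale1r -[adj _ \bo _]scale1r; apply: (isrep_lin HR); first exact: arr_isrep.
  move=> h; rewrite /= (Rb' _).1 (Rb _).1 (Rb _).2 (Rb' _).2 /act_right.
  by rewrite adjN adj_comp !(bcompNl, bcompNr) !opprK !bcompA.
Qed.

(** On a unit vector the image involves four products, each bounded by |T| because every block of
    [T] is. *)
Lemma emb_rep_le p : Rcl t p.2 -> emb_vec_norm p <= 1 ->
  emb_vec_norm (emb_rep t a p) <= 4 * rnorm T.
Proof.
case: p => f' B' /= /Rcl_isrep[be' Sb' Rb'] p1.
rewrite (emb_rep_norm f' Sb' Rb').
have h11 : rnorm al <= rnorm T by rewrite -(block11K al f (adj g) be) rnorm_block11.
have h12 : rnorm (tro_val f) <= rnorm T by rewrite -(block12K al f (adj g) be) rnorm_block12.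
have h21 : rnorm (adj (tro_val g)) <= rnorm T.
  by rewrite -(block21K al f (adj g) be) rnorm_block21.
have h22 : rnorm be <= rnorm T by rewrite -(block22K al f (adj g) be) rnorm_block22.
rewrite (emb_vec_norm_rep _ Sb' Rb') in p1.
have [f1 b1] : rnorm (tro_val f') <= 1 /\ rnorm be' <= 1.
  split; apply: le_trans p1; rewrite -[leLHS]ger0_norm ?rnorm_ge0// -sqrtr_sqr ler_wsqrtr//.
    by rewrite lerDl sqr_ge0.
  by rewrite lerDr sqr_ge0.
have small (U W X : normedModType R[i]) (u : bop W X) (v : bop U W) :
    rnorm u <= rnorm T -> rnorm v <= 1 -> rnorm (u \bo v) <= rnorm T.
  move=> uT v1; rewrite (le_trans (rnorm_bcomp _ _))// (le_trans _ uT)//.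
  by rewrite ler_piMr ?rnorm_ge0.
rewrite (le_trans (l2norm_le _ _)) ?rnorm_ge0//.
have k1 := small _ _ _ _ _ h11 f1; have k2 := small _ _ _ _ _ h12 b1.
have k3 := small _ _ _ _ _ h21 f1; have k4 := small _ _ _ _ _ h22 b1.
have := ler_rnormD (al \bo tro_val f') (tro_val f \bo be').
have := ler_rnormB (adj (tro_val g) \bo tro_val f') (be \bo be').
lra.
Qed.

Lemma emb_norm_has_sup : has_sup [set emb_vec_norm (emb_rep t a p) |
  p in [set p : M * opair M | Rcl t p.2 /\ emb_vec_norm p <= 1]].
Proof.
split; last by exists (4 * rnorm T) => _ [p [Rp p1] <-]; exact: emb_rep_le.
exists (emb_vec_norm (emb_rep t a (0, 0))), (0, 0) => //; split => /=.
  by apply/Rcl_isrep; exists 0; [exact: trep0 HR|exact: isrep0 HR].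
rewrite (emb_vec_norm_rep 0 (trep0 HR) (isrep0 HR)) !rnorm0 /l2norm expr0n addr0 sqrtr0.
exact: ler01.
Qed.

Lemma emb_norm_le : emb_norm t a <= 4 * rnorm T.
Proof.
apply: ge_sup; first by case: emb_norm_has_sup.
by move=> _ [p [Rp p1] <-]; exact: emb_rep_le.
Qed.

Lemma emb_norm_ub p : Rcl t p.2 -> emb_vec_norm p <= 1 ->
  emb_vec_norm (emb_rep t a p) <= emb_norm t a.
Proof. by move=> Rp p1; apply: (sup_upper_bound emb_norm_has_sup); exists p. Qed.

Lemma l2norm_ge (x y : R) : 0 <= x -> 0 <= y -> x <= l2norm x y /\ y <= l2norm x y.
Proof.
move=> x0 y0; split; rewrite -[leLHS]ger0_norm// -sqrtr_sqr ler_wsqrtr//.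
  by rewrite lerDl sqr_ge0.
by rewrite lerDr sqr_ge0.
Qed.

Lemma emb_norm_ge0 : 0 <= emb_norm t a.
Proof.
apply: (le_trans _ (@emb_norm_ub (0, 0) _ _)); first exact: sqrtr_ge0.
  by apply/Rcl_isrep; exists 0; [exact: trep0 HR|exact: isrep0 HR].
rewrite (emb_vec_norm_rep 0 (trep0 HR) (isrep0 HR)) !rnorm0 /l2norm expr0n addr0 sqrtr0.
exact: ler01.
Qed.

Lemma emb_norm_fst (f' : M) : rnorm f' <= 1 ->
  rnorm (al \bo tro_val f') <= emb_norm t a /\ rnorm (adj (tro_val g) \bo tro_val f') <= emb_norm t a.
Proof.
move=> f1; have := @emb_norm_ub (f', 0).
rewrite (emb_rep_norm f' (trep0 HR) (isrep0 HR)) (emb_vec_norm_rep f' (trep0 HR) (isrep0 HR)).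
rewrite !bcomp0r addr0 subr0 rnorm0 {1}/l2norm [0 ^+ 2]expr0n addr0 sqrtr_sqr ger0_norm ?rnorm_ge0//.
move=> /(_ _ f1) h; have {}h := h (iffRL (Rcl_isrep _) (ex_intro2 _ _ 0 (trep0 HR) (isrep0 HR))).
have [h1 h2] := l2norm_ge (rnorm_ge0 (al \bo tro_val f')) (rnorm_ge0 (adj (tro_val g) \bo tro_val f')).
by split; apply: le_trans h.
Qed.

Lemma emb_norm_snd be' : SH be' -> rnorm be' <= 1 ->
  rnorm (tro_val f \bo be') <= emb_norm t a /\ rnorm (be \bo be') <= emb_norm t a.
Proof.
move=> Sb' b1; have [B' Rb'] := isrep_exists HR Sb'.
have := @emb_norm_ub (0, B'); rewrite (emb_rep_norm 0 Sb' Rb') (emb_vec_norm_rep 0 Sb' Rb').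
rewrite !bcomp0r add0r sub0r rnormN rnorm0 {1}/l2norm [0 ^+ 2]expr0n add0r sqrtr_sqr.
rewrite ger0_norm ?rnorm_ge0// => h; have {}h := h (iffRL (Rcl_isrep _) (ex_intro2 _ _ be' Sb' Rb')) b1.
have [h1 h2] := l2norm_ge (rnorm_ge0 (tro_val f \bo be')) (rnorm_ge0 (be \bo be')).
by split; apply: le_trans h.
Qed.

Lemma emb_norm_ge : rnorm T <= 4 * emb_norm t a.
Proof.
have N0 := emb_norm_ge0.
have cancel (x c : R) : 0 <= x -> 0 <= c -> x * x <= c * x -> x <= c.
  move=> x0 c0; have [->//|xn0] := eqVneq x 0.
  by rewrite ler_pM2r// lt_neqAle eq_sym xn0.
have SHZ (r : R) x : SH x -> SH (r%:C%C *: x).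
  by move=> Sx; rewrite -[_ *: x]addr0; apply: (trep_lin HR) => //; exact: (trep0 HR).
have h11 : rnorm al <= emb_norm t a.
  apply: (trep_lower HL Sa N0) => f'; rewrite rnormN.
  apply: (@homogeneous_bound _ M (bop H K) setT (fun f' => al \bo tro_val f') _ _ _ _ f') => //.
    by move=> r x; rewrite tro_valZ bcompZr.
  by move=> x _ x1; exact: (emb_norm_fst x1).1.
(* The test vector is [g] itself, since |g^* g| = |g|^2; [cancel] removes one factor |g|, which may
   be zero. *)
have h21 : rnorm (adj (tro_val g)) <= emb_norm t a.
  rewrite rnorm_adj; apply: cancel; rewrite ?rnorm_ge0// -expr2 -rnorm_adj_comp.
  apply: (@homogeneous_bound _ M (bop H H) setT (fun f' => adj (tro_val g) \bo tro_val f') _ _ _ _ g) => //.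
    by move=> r x; rewrite tro_valZ bcompZr.
  by move=> x _ x1; exact: (emb_norm_fst x1).2.
have h12 : rnorm (tro_val f) <= emb_norm t a.
  have [/eqP -> //|f0] := boolP (rnorm (tro_val f) == 0).
  have f1 : 0 < rnorm (tro_val f) by rewrite lt_neqAle eq_sym f0 rnorm_ge0.
  rewrite -(ler_pM2r (exprn_gt0 2 f1)) -exprS -[X in _ <= _ * X]rnorm_adj_comp.
  have /= <- := rnorm_tro3 f; rewrite -bcompA.
  apply: (@homogeneous_bound _ (bop H H) (bop H K) SH (fun b => tro_val f \bo b)) => //.
  - by move=> r x; rewrite bcompZr.
  - by move=> x Sx x1; exact: (emb_norm_snd Sx x1).1.
  - exact: corner_right_gen HS _ _.
have h22 : rnorm be <= emb_norm t a.
  apply: cancel; rewrite ?rnorm_ge0// -[X in X * X]rnorm_adj -expr2 -rnorm_adj_comp adjK.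
  rewrite -[X in _ <= _ * X]rnorm_adj.
  apply: (@homogeneous_bound _ (bop H H) (bop H H) SH (fun b => be \bo b)) => //.
  - by move=> r x; rewrite bcompZr.
  - by move=> x Sx x1; exact: (emb_norm_snd Sx x1).2.
  - exact: trep_adj HR _ Sb.
have := rnorm_block_le al (tro_val f) (adj (tro_val g)) be.
rewrite -/T; lra.
Qed.

End fixed.

Lemma emb_norm_equiv a T : rel a T -> emb_norm t a <= 4 * rnorm T /\ rnorm T <= 4 * emb_norm t a.
Proof.
case: a => [[A f] [g B]] [al [be [Sa Sb La Rb ->]]].
by split; [exact: emb_norm_le|exact: emb_norm_ge].
Qed.

End embedding_norm.

Theorem proposition2p2 (R : realType) (H K : hilbertType R) (V : tro H K) :
  let t := @anti_triple R H K V in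
  cstar_ternary_ring t /\
  exists phi0 : embmx (tro_sort V) -> bop (l2sum K H) (l2sum K H),
    [/\ forall x y z w u v : tro_sort V,
          phi0 (Mx (ell t x y) z w (arr t u v)) =
          block (tro_val x \bo adj y) z (adj w) (adj u \bo tro_val v),
        star_isomorphism (emb0 t) (emb_mul t) (@emb_star _ _)
          (B0 V) (@block_mul _ _ _) (@block_star _ _ _) phi0 &
        exists phi : embmx (tro_sort V) -> bop (l2sum K H) (l2sum K H),
          [/\ forall a, emb0 t a -> emb t a /\ phi a = phi0 a,
              star_isomorphism (emb t) (emb_mul t) (@emb_star _ _)
                (closure (B0 V)) (@block_mul _ _ _) (@block_star _ _ _) phi,
              bicontinuous (emb_norm t) (@rnorm _ _) (emb t) phi,
              {within closure (B0 V) `*` closure (B0 V),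
                continuous (fun T => block_mul T.1 T.2)} &
              {within closure (B0 V), continuous (@block_star R H K)}]].
Proof.
move=> t; split; first exact: anti_triple_cstar.
have HS := ncl_corner_algebras V.
pose rel := @emb_rel R H K V (ncl (fsumsK V)) (ncl (fsumsH V)).
(* Chosen on the closed relation, which contains the algebraic one, so this single function serves
   as both [phi0] and its extension. Off [emb] it takes the default value 0. *)
pose phi a := xget 0 (rel a).
have relphi a T : rel a T -> phi a = T.
  by move=> aT; apply: (emb_rel_fun HS _ aT); exact: (xgetI 0 aT).
exists phi; split.
- move=> x y z w u v; apply: relphi; apply: emb_rel_ncl.
  exists (tro_val x \bo adj y), (adj u \bo tro_val v); split => //.
  + exact: fsumsK_gen.
  + exact: fsumsH_gen.
  + exact: ell_isrep.
  + exact: arr_isrep.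
- rewrite emb0_rel B0_rel; apply: (emb_star_isomorphism (fsums_corner_algebras V)).
  by move=> a T /emb_rel_ncl; exact: relphi.
exists phi; split.
- move=> a; rewrite emb0_rel emb_relc => -[T aT]; split=> //.
  by exists T; exact: emb_rel_ncl.
- by rewrite emb_relc closure_B0_rel; exact: emb_star_isomorphism.
(* The norm comparison concerns a single matrix; linearity of the relation lets it be applied to the
   difference [b - a]. *)
- have norms a b : emb t a -> emb t b -> emb_norm t (b - a) <= 4 * rnorm (phi b - phi a) /\
      rnorm (phi b - phi a) <= 4 * emb_norm t (b - a).
    rewrite emb_relc => -[T aT] [T' bT'].
    rewrite (relphi _ _ aT) (relphi _ _ bT'); apply: emb_norm_equiv.
    rewrite [b - a]addrC [T' - T]addrC -[- a]scaleN1r -[- T]scaleN1r.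
    exact: (emb_rel_lin HS).
  split=> a aS e e0; exists (e / 4); rewrite ?divr_gt0// => b bS h;
    have := norms a b aS bS; lra.
- exact/continuous_subspaceT/continuous_block_mul.
- exact/continuous_subspaceT/continuous_block_star.
Qed.
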